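(* Let $C\subset\mathbb{S}^{n-1}$ be a spherical $2k$-design with $|C|>D(n,2k)$, let $y\in\mathbb{S}^{n-1}$ be a point realizing the covering radius of $C$, let $\ell>-1$ be such that $t_1(y)\in[-1,\ell]$, and let $s$ be a real number with $t_{|C|-m(C)}(y)\le s<t_{FL}$. Let $j\in\{0,1,\dots,m(C)-n\}$ be such that $$t_{|C|-m(C)+j}(y)<t_{FL}\le t_{|C|-m(C)+j+1}(y).$$ If $g(t)\in B(n,k,s)$, then $\rho(C)\ge m_{\ell,s}^{(j)}$, where $m_{\ell,s}^{(j)}$ is the largest (real) root of the equation $$j\,g(t_{FL})+(m(C)-j)\,g(t)=g_0|C|$$ in the unknown $t$.
   Context: Here $n\ge2$, $k\ge1$ are integers. A finite set $C\subset\mathbb{S}^{n-1}\subset\mathbb{R}^n$ is a spherical $\tau$-design if for every polynomial of degree at most $\tau$ in $n$ variables its average over $C$ equals its average over $\mathbb{S}^{n-1}$ with respect to the (rotation-invariant) Lebesgue measure; it is assumed that $C$ spans $\mathbb{R}^n$. $D(n,2k)=\binom{n+k-1}{n-1}+\binom{n+k-2}{n-1}$. $\rho(C):=\min_{y\in\mathbb{S}^{n-1}}\max_{x\in C}\langle x,y\rangle$ (equivalently $1-r(C)^2/2$ with $r(C)$ the covering radius in Euclidean distance); $y$ realizes the covering radius if $\max_{x\in C}\langle x,y\rangle=\rho(C)$. The multiset $\{\langle x,y\rangle:x\in C\}$ is ordered as $t_1(y)\le t_2(y)\le\cdots\le t_{|C|}(y)$. For a real polynomial $f$, $f_0:=c_n\int_{-1}^1f(t)(1-t^2)^{(n-3)/2}dt$,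 $c_n=\Gamma(n/2)/(\sqrt\pi\,\Gamma((n-1)/2))$ (the constant coefficient of the Gegenbauer expansion of $f$). $t_{FL}=t_k^{0,1}$ is the largest zero of the Jacobi polynomial $P_k^{(\alpha,\beta)}(t)$ of degree $k$ with $\alpha=\frac{n-3}2$, $\beta=\frac{n-1}2$. $A(n,k,\ell)$ is the set of polynomials $f(t)=A^2(t)$ with $\deg(f)=2k$, where the real polynomial $A$ has $k$ real zeros (with multiplicity) in $[\ell,t_{FL}]$. $B(n,k,s)$ is the set of polynomials $g(t)=(t+1)B^2(t)(t-s)$ with $\deg(g)=2k$, where the real polynomial $B$ has $k-1$ real zeros (with multiplicity) in $[-1,s]$. $m(C)$ is the smallest positive integer $m$ for which there exists $f\in A(n,k,\ell)$ with $f_0|C|<f(\ell)+(m+1)f(t_{FL})$; it is assumed that such $m$ exists and that $m(C)\le|C|-1$. *)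

(* Defs.v *)
From mathcomp Require Import all_boot all_order all_algebra finmap.
From mathcomp Require Import -(notations) mpoly.
From mathcomp Require Import all_classical all_reals all_analysis.
Import Order.TTheory GRing.Theory Num.Theory.
Import numFieldNormedType.Exports.

Set Implicit Arguments.
Unset Strict Implicit.
Unset Printing Implicit Defensive.

Local Open Scope classical_set_scope.
Local Open Scope ring_scope.

Definition is_largest (R : realType) (E : set R) (t : R) : Prop :=
  E t /\ ubound E t.

Definition dot (R : realType) (n : nat) (x y : 'rV[R]_n) : R :=
  \sum_(i < n) x ord0 i * y ord0 i.

(* S^(n-1) *)
Definition sphere (R : realType) (n : nat) : set 'rV[R]_n :=
  [set x | dot x x = 1].

Definition borel (R : realType) (n : nat) :=
  g_sigma_algebraType (@open 'rV[R]_n).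

(* [sigma] is the normalized Lebesgue (surface) measure of S^(n-1), seen as a
   Borel measure on R^n carried by S^(n-1).  For n >= 2 there is exactly one
   rotation-invariant Borel probability measure on S^(n-1). *)
Definition is_sphere_measure (R : realType) (n : nat)
    (sigma : probability (borel R n) R) : Prop :=
  sigma (@sphere R n) = 1%E /\
  forall (U : 'M[R]_n) (A : set (borel R n)),
    U *m U^T = 1%:M -> \det U = 1 -> measurable A ->
    sigma [set x : borel R n | A ((x : 'rV[R]_n) *m U)] = sigma A.

Definition peval (R : realType) (n : nat) (p : mpoly n R)
    (x : 'rV[R]_n) : R :=
  meval (fun i => x ord0 i) p.

(* [msize p] is 1 + the total degree of [p] (0 if [p = 0]).  As the
   measure [sigma] is unique, [exists] only serves to name it. *)
Definition spherical_design (R : realType) (n tau : nat)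
    (C : {fset 'rV[R]_n}) : Prop :=
  (forall x, x \in C -> @sphere R n x) /\
  exists sigma : probability (borel R n) R,
    is_sphere_measure sigma /\
    forall p : mpoly n R, (msize p <= tau.+1)%N ->
      (#|` C|%:R)^-1 * (\sum_(x <- C) peval p x) =
      \int[sigma]_(x in @sphere R n) peval p x.

Definition spans (R : realType) (n : nat) (C : {fset 'rV[R]_n}) : Prop :=
  (<<enum_fset C>> = fullv)%VS.

Definition D2k (n k : nat) : nat :=
  'C(n + k - 1, n - 1) + 'C(n + k - 2, n - 1).

(* max over x in C of <x, y>; -1 is a neutral default, since <x, y> >= -1 for
   unit vectors. *)
Definition max_dot (R : realType) (n : nat) (C : {fset 'rV[R]_n})
    (y : 'rV[R]_n) : R :=
  \big[Num.max/-1]_(x <- C) dot x y.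

(* The infimum is attained, by compactness of the sphere. *)
Definition rho (R : realType) (n : nat) (C : {fset 'rV[R]_n}) : R :=
  inf [set max_dot C y | y in @sphere R n].

Definition realizes_covering_radius (R : realType) (n : nat)
    (C : {fset 'rV[R]_n}) (y : 'rV[R]_n) : Prop :=
  @sphere R n y /\ max_dot C y = rho C.

(* t_i(y), for 1 <= i <= |C|: indices start at 1. *)
Definition t_ (R : realType) (n : nat) (C : {fset 'rV[R]_n})
    (y : 'rV[R]_n) (i : nat) : R :=
  nth 0 (sort <=%R [seq dot x y | x <- enum_fset C]) i.-1.

Definition Gamma (R : realType) (a : R) : R :=
  \int[lebesgue_measure]_(u in `]0, +oo[) (u `^ (a - 1) * expR (- u)).

Definition cn (R : realType) (n : nat) : R :=
  Gamma (n%:R / 2) / (Num.sqrt pi * Gamma ((n%:R - 1) / 2)).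

(* f_0; for n = 2 the weight is singular at -1 and 1, a null set on which [`^]
   takes a finite default value. *)
Definition gegenbauer0 (R : realType) (n : nat) (f : {poly R}) : R :=
  cn R n * \int[lebesgue_measure]_(t in `[-1, 1])
             (f.[t] * (1 - t ^+ 2) `^ ((n%:R - 3) / 2)).

Definition gbinom (R : realType) (a : R) (r : nat) : R :=
  (\prod_(i < r) (a - i%:R)) / r`!%:R.

(* P_k^(a,b), by the explicit formula [Szego, Orthogonal Polynomials, (4.3.2)]
   valid for all a, b *)
Definition jacobi (R : realType) (a b : R) (k : nat) : {poly R} :=
  \sum_(i < k.+1)
    (gbinom (k%:R + a) (k - i) * gbinom (k%:R + b) i) *:
      ((2^-1 *: ('X - 1)) ^+ i * (2^-1 *: ('X + 1)) ^+ (k - i)).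

(* The default value 0 is never used for n >= 2 and k >= 1: all k zeros are
   then real and simple. *)
Definition tFL (R : realType) (n k : nat) : R :=
  xget 0 (is_largest
    [set t : R | root (jacobi ((n%:R - 3) / 2) ((n%:R - 1) / 2) k) t]).

Definition has_zeros_in (R : realType) (p : {poly R}) (d : nat) (a b : R) :
    Prop :=
  exists zs : seq R,
    [/\ size zs = d, all (fun z => a <= z <= b) zs
      & \prod_(z <- zs) ('X - z%:P) %| p].

Definition polysA (R : realType) (n k : nat) (l : R) : set {poly R} :=
  [set f | size f = (2 * k).+1 /\
     exists A : {poly R}, f = A ^+ 2 /\ has_zeros_in A k l (tFL R n k)].

(* B(n,k,s) does not depend on n. *)
Definition polysB (R : realType) (k : nat) (s : R) : set {poly R} :=
  [set g | size g = (2 * k).+1 /\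
     exists B : {poly R}, g = ('X + 1) * B ^+ 2 * ('X - s%:P) /\
       has_zeros_in B (k - 1) (-1) s].

Definition mC_cond (R : realType) (n k : nat) (l : R)
    (C : {fset 'rV[R]_n}) (m : nat) : Prop :=
  exists2 f, polysA n k l f &
    gegenbauer0 n f * #|` C|%:R < f.[l] + m.+1%:R * f.[tFL R n k].

Definition is_mC (R : realType) (n k : nat) (l : R)
    (C : {fset 'rV[R]_n}) (m : nat) : Prop :=
  [/\ (0 < m)%N, mC_cond k l C m
    & forall m', (0 < m')%N -> mC_cond k l C m' -> (m <= m')%N].

(* Main.v *)
(* The polynomial [g] is nonpositive on [[-1, s]] and strictly increasing on
   [[s, oo)].  For a design, the sum of [g(<x, y>)] over [C] is [g_0 |C|].
   Dropping the [|C| - m] smallest inner products, bounding the next [j] terms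
   by [g(tFL)] and the last [m - j] ones by [g(rho)], one gets
   [g_0 |C| <= j g(tFL) + (m - j) g(rho)], which forbids [rho < M].

   The sphere average of [g(<x, y>)] is [g_0] because the moments of [<x, y>]
   under an invariant measure and those of the weight [(1 - t^2)^((n-3)/2)]
   satisfy the same recursion [r X_(r-1) = (n - 1 + r) X_(r+1)]: on the sphere
   side it expresses the vanishing of the mean of the infinitesimal plane
   rotations applied to [<x, y>^r x_b], on the other side it is an integration
   by parts.  Both sequences start at 1 since [c_n] normalizes the weight, by
   the functional equation of Gamma and the values Gamma(1), Gamma(1/2). *)

Require Import Defs.
From mathcomp Require Import all_boot all_order all_algebra finmap.
From mathcomp Require Import -(notations) mpoly.
From mathcomp Require Import all_classical all_reals all_analysis.
From mathcomp Require Import measurable_realfun ring lra zify.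
Import Order.TTheory GRing.Theory Num.Theory.
Import numFieldNormedType.Exports.
Local Open Scope classical_set_scope.
Local Open Scope ring_scope.

Set Implicit Arguments.
Unset Strict Implicit.
Unset Printing Implicit Defensive.

(** * Polynomials of B(n,k,s) and sorted inner products *)

(** Comparing degrees forces [B] to have degree [k - 1], so its prescribed zeros exhaust it up to a
    nonzero constant. Sign and monotonicity of [g] can then be read off from linear factors. *)
Lemma polysB_factor (R : realType) (k : nat) (s : R) (g : {poly R}) :
  (1 <= k)%N -> polysB k s g ->
  exists (c : R) (zs : seq R), [/\ c != 0, all (fun z => z <= s) zs
    & forall t, g.[t] = (t + 1) * (c * \prod_(z <- zs) (t - z)) ^+ 2 * (t - s)].
Proof.
(* The defining equation compares coefficient sequences; [val_inj] lifts it to polynomials. *)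
move=> k1 [sg [B [/val_inj gE [zs [szs zsP /dvdpP[q BE]]]]]].
have B0 : B != 0.
  apply/eqP => B0; move: sg; rewrite gE B0 expr0n /= mulr0 mul0r size_poly0.
  by [].
have sB : size B = k.
  have X1 : ('X + 1 : {poly R}) != 0 by rewrite -size_poly_eq0 size_XaddC.
  move: sg; rewrite gE size_mul ?polyXsubC_eq0 ?mulf_neq0 ?expf_neq0 //.
  rewrite size_XsubC size_mul ?expf_neq0 // size_XaddC expr2 size_mul //.
  have : (0 < size B)%N by rewrite size_poly_gt0.
  move: (size B) => b; clear; lia.
have q0 : q != 0 by apply: contraNneq B0 => q0; rewrite BE q0 mul0r.
have [c c0 qE] : exists2 c, c != 0 & q = c%:P.
  apply/size_poly1P; apply/eqP; move: sB.
  rewrite BE size_mul //; last by rewrite -size_poly_eq0 size_prod_XsubC.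
  rewrite size_prod_XsubC szs subn1 prednK // => h.
  have : (size q + k = k.+1)%N.
    rewrite -[in RHS]h prednK // addn_gt0; by rewrite k1 orbT.
  by rewrite -add1n => /addIn ->.
exists c, zs; split => //.
  by apply: sub_all zsP => z /andP[].
move=> t; have -> : \prod_(z <- zs) (t - z) = (\prod_(z <- zs) ('X - z%:P)).[t].
  by rewrite horner_prod; apply: eq_bigr => z _; rewrite !hornerE.
by rewrite gE BE qE !hornerE.
Qed.

Lemma polysB_le0 (R : realType) (k : nat) (s t : R) (g : {poly R}) :
  (1 <= k)%N -> polysB k s g -> -1 <= t -> t <= s -> g.[t] <= 0.
Proof.
move=> k1 /(polysB_factor k1)[c [zs [_ _ gE]]] t1 ts.
rewrite gE mulr_ge0_le0 ?subr_le0 // mulr_ge0 ?sqr_ge0 //.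
by rewrite -lerBlDr sub0r.
Qed.

(** To the right of [s] every factor is nonnegative and nondecreasing. Strictness comes from
    [(t + 1) * (t - s)]: the squared product may vanish at [t], but it is positive at [u], which
    suffices. *)
Lemma polysB_incr (R : realType) (k : nat) (s t u : R) (g : {poly R}) :
  (1 <= k)%N -> polysB k s g -> -1 <= s -> s <= t -> t < u -> g.[t] < g.[u].
Proof.
move=> k1 /(polysB_factor k1)[c [zs [c0 zss gE]]] s1 st tu.
rewrite !gE.
have Pt : 0 <= \prod_(z <- zs) (t - z).
  rewrite big_seq; apply: prodr_ge0 => z zin; rewrite subr_ge0.
  by rewrite (le_trans _ st) // (allP zss).
have Pu : 0 < \prod_(z <- zs) (u - z).
  rewrite big_seq; apply: prodr_gt0 => z zin; rewrite subr_gt0.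
  by apply: le_lt_trans (allP zss z zin) _; apply: le_lt_trans tu.
have Ptu : \prod_(z <- zs) (t - z) <= \prod_(z <- zs) (u - z).
  rewrite big_seq [leRHS]big_seq; apply: ler_prod => z zin.
  rewrite subr_ge0 (le_trans (allP zss z zin) st) /=.
  by rewrite lerD2r ltW.
set p := \prod_(z <- zs) (t - z) in Pt Ptu *.
set q := \prod_(z <- zs) (u - z) in Pu Ptu *.
rewrite !exprMn.
have c2 : 0 < c ^+ 2 by rewrite exprn_even_gt0.
have pq2 : p ^+ 2 <= q ^+ 2 by rewrite ler_sqr ?nnegrE // ltW.
have q2 : 0 < q ^+ 2 by rewrite exprn_gt0.
have h : (t + 1) * (t - s) < (u + 1) * (u - s) by nra.
rewrite mulrAC [ltRHS]mulrAC.
apply: (@le_lt_trans _ _ ((t + 1) * (t - s) * (c ^+ 2 * q ^+ 2))).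
  rewrite ler_wpM2l // ?mulr_ge0 ?subr_ge0 //; first by lra.
  by rewrite ler_pM2l.
by rewrite ltr_pM2r // mulr_gt0.
Qed.

(** Below [s] there is no monotonicity, but there [g] is nonpositive, and [g] vanishes at [s]. This
    covers inner products of large index that still lie below [s]. *)
Lemma polysB_incrW (R : realType) (k : nat) (s t u : R) (g : {poly R}) :
  (1 <= k)%N -> polysB k s g -> -1 <= t -> -1 <= s -> s <= u -> t <= u ->
  g.[t] <= g.[u].
Proof.
move=> k1 hg t1 s1 su; rewrite le_eqVlt => /predU1P[->//|tu].
have [st|ts] := leP s t; first exact/ltW/(polysB_incr k1 hg s1).
apply: (@le_trans _ _ 0); first exact: polysB_le0 k1 hg t1 (ltW ts).
move: su; rewrite le_eqVlt => /predU1P[<-|su].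
  have [c [zs [_ _ gE]]] := polysB_factor k1 hg.
  by rewrite gE subrr mulr0.
have [c [zs [_ _ gE]]] := polysB_factor k1 hg.
have -> : 0 = g.[s] by rewrite gE subrr mulr0.
exact/ltW/(polysB_incr k1 hg s1).
Qed.

Lemma t_le (R : realType) (n : nat) (C : {fset 'rV[R]_n}) (y : 'rV[R]_n) a b :
  (0 < a)%N -> (a <= b)%N -> (b <= #|` C|)%N -> t_ C y a <= t_ C y b.
Proof.
move=> a0 ab bC; rewrite /t_.
have sz : size (sort <=%R [seq dot x y | x <- enum_fset C]) = #|` C|.
  by rewrite size_sort size_map cardfE -cardfE.
have b0 : (0 < b)%N := leq_trans a0 ab.
apply: (sorted_leq_nth le_trans le_refl).
- exact/sort_sorted/le_total.
- by rewrite inE sz prednK // (leq_trans ab).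
- by rewrite inE sz prednK.
- by rewrite -ltnS !prednK.
Qed.

Lemma t_max_dot (R : realType) (n : nat) (C : {fset 'rV[R]_n}) (y : 'rV[R]_n) a :
  (0 < a)%N -> (a <= #|` C|)%N -> t_ C y a <= max_dot C y.
Proof.
move=> a0 aC; rewrite /t_.
set r := sort _ _.
have : nth 0 r a.-1 \in r.
  by apply: mem_nth; rewrite size_sort size_map cardfE -cardfE prednK.
rewrite mem_sort => /mapP[x xC ->].
rewrite /max_dot; elim: (enum_fset C) xC => //= h u IH.
rewrite inE big_cons le_max => /predU1P[<-|/IH ->]; first by rewrite lexx.
by rewrite orbT.
Qed.

Lemma sum_t (R : realType) (n : nat) (C : {fset 'rV[R]_n}) (y : 'rV[R]_n)
    (f : R -> R) :
  \sum_(x <- C) f (dot x y) = \sum_(1 <= i < (#|` C|).+1) f (t_ C y i).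
Proof.
rewrite /t_ big_add1 /=.
rewrite -(big_map (fun x => dot x y) xpredT f).
rewrite -(perm_big _ (permEl (perm_sort <=%R _))) /=.
by rewrite (big_nth 0) size_sort size_map.
Qed.

(** The counting argument, separated from the analysis: the design enters only through the value [G]
    of the sum. If [M] exceeded the largest inner product, [g] would be strictly larger at [M],
    against the upper bound on [G] obtained from three blocks of indices. *)
Lemma bound_of_identity (R : realType) (n k : nat) (C : {fset 'rV[R]_n})
    (y : 'rV[R]_n) (s G M tf : R) (m j : nat) (g : {poly R}) :
  (1 <= k)%N -> -1 <= t_ C y 1 -> (m <= #|` C| - 1)%N -> (j < m)%N ->
  t_ C y (#|` C| - m) <= s < tf ->
  t_ C y (#|` C| - m + j) < tf <= t_ C y (#|` C| - m + j + 1) ->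
  polysB k s g ->
  \sum_(x <- C) g.[dot x y] = G ->
  j%:R * g.[tf] + (m%:R - j%:R) * g.[M] = G ->
  M <= max_dot C y.
Proof.
move=> k1 t1 mC jm /andP[ts stf] /andP[tjl tju] hg sumG hM.
set N := #|` C| in mC ts tjl tju *.
have N0 : (0 < N)%N.
  by have := leq_ltn_trans (leq0n j) jm; move: mC; clear; lia.
have Nm : (0 < N - m)%N.
  by rewrite subn_gt0; apply: leq_ltn_trans mC _; rewrite subn1 prednK.
have mN : (m <= N)%N by rewrite ltnW // -subn_gt0.
have tge i : (0 < i <= N)%N -> -1 <= t_ C y i.
  by move=> /andP[i0 iN]; apply: le_trans t1 _; apply: t_le.
have s1 : -1 <= s.
  by apply: le_trans (tge _ _) ts; rewrite Nm leq_subr.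
have Njm : (N - m + j + 1 <= N)%N.
  by rewrite addn1 -addnS -[leqRHS](subnK mN) leq_add2l.
have tfrho : tf <= max_dot C y.
  by apply: (le_trans tju); apply: t_max_dot => //; rewrite addn1.
rewrite leNgt; apply/negP => rhoM.
have incr : g.[max_dot C y] < g.[M].
  by apply: (polysB_incr k1 hg s1) rhoM; apply/ltW/(lt_le_trans stf).
(* Since [j < m], the coefficient [m - j] is positive and can be cancelled after [G] is replaced
   through [hM]; what remains contradicts [incr]. *)
suff : G <= j%:R * g.[tf] + (m%:R - j%:R) * g.[max_dot C y].
  by rewrite -hM lerD2l ler_pM2l ?subr_gt0 ?ltr_nat // leNgt incr.
rewrite -sumG (sum_t C y (fun t => g.[t])) -/N.
have h1 : (1 <= (N - m).+1)%N by [].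
have h2 : ((N - m).+1 <= (N - m + j).+1)%N by rewrite ltnS leq_addr.
have h3 : ((N - m + j).+1 <= N.+1)%N.
  by rewrite ltnS (leq_trans _ Njm) // addn1.
(* The blocks are the indices up to [N - m], where [g] is nonpositive, the next [j], where the inner
   product is below [tf], and the last [m - j], where only the maximum bounds it. *)
rewrite (big_cat_nat h1 (leq_trans h2 h3)) /= (big_cat_nat h2 h3) /=.
rewrite -[leRHS]add0r; apply: lerD.
  rewrite big_nat_cond; apply: sumr_le0 => i; rewrite andbT ltnS => /andP[i0 iN].
  apply: (polysB_le0 k1 hg).
    by apply: tge; rewrite i0 (leq_trans iN) // leq_subr.
  by apply: le_trans ts; apply: t_le => //; exact: leq_subr.
apply: lerD.
  rewrite big_nat_cond.
  apply: (@le_trans _ _ (\sum_((N - m).+1 <= i < (N - m + j).+1) g.[tf])).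
    rewrite [leRHS]big_nat_cond; apply: ler_sum => i; rewrite andbT ltnS.
    move=> /andP[i0 iN].
    have iC : (i <= N)%N by apply: (leq_trans iN); rewrite (leq_trans _ Njm) // addn1.
    have i1 : (0 < i)%N by apply: leq_ltn_trans i0.
    apply: (polysB_incrW k1 hg) => //; first by apply: tge; rewrite i1.
      exact: ltW.
    by apply: le_trans (ltW tjl); apply: t_le => //; apply: ltnW; rewrite addn1 in Njm.
  by rewrite sumr_const_nat subSS addKn mulr_natl.
apply: (@le_trans _ _ (\sum_((N - m + j).+1 <= i < N.+1) g.[max_dot C y])).
  rewrite big_nat_cond [leRHS]big_nat_cond; apply: ler_sum => i; rewrite andbT ltnS.
  move=> /andP[i0 iN].
  have i1 : (0 < i)%N by apply: leq_ltn_trans i0.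
  apply: (polysB_incrW k1 hg) => //; first by apply: tge; rewrite i1.
    by apply/ltW/(lt_le_trans stf).
  exact: t_max_dot.
rewrite -natrB ?(ltnW jm) // mulr_natl sumr_const_nat subSS subnDA subKn //.
Qed.

(** * The Gamma function at half-integers *)

Lemma is_derive_exprn {R : realType} (f : R -> R) (r : nat) (t df : R) :
  is_derive t 1 f df ->
  is_derive t 1 (fun u => f u ^+ r) (r%:R * f t ^+ r.-1 * df).
Proof.
move=> fdf.
have d : is_derive (f t) 1 (fun u : R => u ^+ r) (r%:R * f t ^+ r.-1).
  apply: DeriveDef; first exact: exprn_derivable.
  by rewrite exp_derive /GRing.scale /= mulr1.
exact: (@is_derive1_comp R (fun u => u ^+ r) f t _ _ d fdf).
Qed.

(** * Compact integrals and their limits over growing domains *)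

Section integral_limits.
Context {R : realType}.
Notation mu := (@lebesgue_measure R).

(** Two-sided derivatives up to the endpoints settle the one-sided continuity conditions once and
    for all. *)
Lemma integral_FTC (F f : R -> R) (a b : R) : a < b ->
  (forall x, a <= x <= b -> is_derive x 1 F (f x)) ->
  (forall x, a <= x <= b -> {for x, continuous f}) ->
  (\int[mu]_(x in `[a, b]) (f x)%:E)%E = (F b - F a)%:E.
Proof.
move=> ab dF cf.
have cF x : a <= x <= b -> {for x, continuous F}.
  move=> xab; apply/differentiable_continuous/derivable1_diffP.
  by have := dF x xab => -[].
rewrite (@continuous_FTC2 _ f F) ?EFinB //.
- apply/subspace_continuousP => x /=; rewrite in_itv /= => xab.
  by apply: cvg_within_filter; exact: cf.
- split.
  + by move=> x /itvP xab; have [] := dF x _; rewrite ?xab.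
  + by apply/cvg_at_right_filter/cF; rewrite lexx ltW.
  + by apply/cvg_at_left_filter/cF; rewrite lexx ltW.
- move=> x /itvP xab; rewrite derive1E.
  have xab' : a <= x <= b by rewrite !xab.
  by have := dF x xab' => dFx; rewrite derive_val.
Qed.

Lemma continuous_integrable (f : R -> R) (a b : R) :
  (forall x, a <= x <= b -> {for x, continuous f}) ->
  mu.-integrable `[a, b] (EFin \o f).
Proof.
move=> cf; apply: continuous_compact_integrable; first exact: segment_compact.
apply/subspace_continuousP => x /=; rewrite in_itv /= => xab.
by apply: cvg_within_filter; exact: cf.
Qed.

(** Monotone convergence is applied to the positive and negative parts separately; integrability on
    the union keeps the difference of the two limits well defined. *)
Lemma cvg_integral_bigcup (F : (set R)^nat) (f : R -> \bar R) :
  nondecreasing_seq F -> (forall i, measurable (F i)) ->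
  mu.-integrable (\bigcup_i F i) f ->
  (\int[mu]_(x in F i) f x)%E @[i --> \oo] -->
  (\int[mu]_(x in \bigcup_i F i) f x)%E.
Proof.
move=> ndF mF fint.
have mU : measurable (\bigcup_i F i) by exact: bigcup_measurable.
have mf := measurable_int mu fint.
have mfi i := measurable_funS mU (bigcup_sup (I : setT i)) mf.
rewrite integralE.
under eq_cvg do rewrite integralE.
apply: cvgeB.
- apply: fin_num_adde_defr; exact: integrable_pos_fin_num.
- apply: ge0_nondecreasing_set_cvg_integral => // i.
  exact: measurable_funepos (mfi i).
- apply: ge0_nondecreasing_set_cvg_integral => // i.
  exact: measurable_funeneg (mfi i).
Qed.

End integral_limits.

(** * Functional equation and special values of Gamma *)

Section gamma.
Context {R : realType}.
Notation mu := (@lebesgue_measure R).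
Implicit Types (a x : R).

(** Extended-real version of Gamma: the functional equation is a statement about limits in the
    extended reals and can be proved before finiteness is known. *)
Definition eGamma a := (\int[mu]_(u in `]0%R, +oo[) (u `^ (a - 1) * expR (- u))%:E)%E.

Lemma is_derive_powR a x : 0 < x ->
  is_derive x 1 (fun t : R => t `^ a) (a * x `^ (a - 1)).
Proof.
move=> x0; have x0' : x \in `]0, +oo[ by rewrite in_itv /= x0.
apply: DeriveDef; first exact: derivable_powR.
by rewrite -derive1E powR_derive1.
Qed.

Lemma continuous_powR a x : 0 < x -> {for x, continuous (fun t : R => t `^ a)}.
Proof.
move=> x0; apply/differentiable_continuous/derivable1_diffP.
by have [] := is_derive_powR a x0.
Qed.

Lemma continuous_expRN x : {for x, continuous (fun u : R => expR (- u))}.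
Proof.
by apply: (@continuous_comp _ _ _ -%R expR); [exact: opp_continuous|exact: continuous_expR].
Qed.

Lemma continuous_gamma_fun a x : 0 < x ->
  {for x, continuous (fun u : R => u `^ a * expR (- u))}.
Proof.
move=> x0; apply: cvgM; first exact: continuous_powR.
exact: continuous_expRN.
Qed.

Lemma bigcup_itv0y (a b : R^nat) : (forall i, 0 < a i) ->
  a @ \oo --> (0:R) -> b @ \oo --> +oo ->
  \bigcup_i [set` `[a i, b i]] = `]0, +oo[%classic :> set R.
Proof.
move=> a0 ca cb; apply/seteqP; split => x /=.
  by move=> [i _] /=; rewrite !in_itv /= andbT => /andP[+ _]; exact: lt_le_trans.
rewrite in_itv /= andbT => x0.
have [N1 _ h1] := (cvgryPge b).1 cb x.
have : \forall i \near \oo, a i < x.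
  by apply: cvgr_lt ca _ _.
move=> [N2 _ h2]; exists (maxn N1 N2) => //=.
by rewrite in_itv /= h1 /= ?leq_maxl // ltW // h2 //= leq_maxr.
Qed.

(** Monotone convergence along compact intervals that avoid a possible singularity at 0. *)
Lemma cvg_integral_itv0y (f : R -> R) (a b : R^nat) :
  (forall x, 0 < x -> 0 <= f x) ->
  (forall x, 0 < x -> {for x, continuous f}) ->
  (forall i, 0 < a i) -> nonincreasing_seq a -> nondecreasing_seq b ->
  a @ \oo --> (0:R) -> b @ \oo --> +oo ->
  (\int[mu]_(x in `[a i, b i]) (f x)%:E)%E @[i --> \oo] -->
  (\int[mu]_(x in `]0%R, +oo[) (f x)%:E)%E.
Proof.
move=> f0 cf a0 da db ca cb.
rewrite -(bigcup_itv0y a0 ca cb).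
apply: ge0_nondecreasing_set_cvg_integral => //.
- move=> i k ik; rewrite subsetEset => x /=; rewrite !in_itv /= => /andP[ax xb].
  by rewrite (le_trans (da _ _ ik) ax) (le_trans xb (db _ _ ik)).

- move=> i; apply: (measurable_funS (measurable_itv (`]0, +oo[ : interval R))).
    by move=> x /=; rewrite !in_itv /= andbT => /andP[+ _]; exact: lt_le_trans.
  apply/measurable_EFinP.
  apply: (@open_continuous_measurable_fun R) => //.
  by move=> x; rewrite in_setE /= in_itv /= andbT; exact: cf.
- move=> i x /=; rewrite in_itv /= => /andP[ax _]; rewrite lee_fin f0 //.
  exact: lt_le_trans ax.
Qed.

Lemma cvg_natSy : (i.+1%:R : R) @[i --> \oo] --> +oo.
Proof.
have := @cvgr_idn R; rewrite -(cvg_shiftS (fun i => i%:R : R)); exact.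
Qed.

(** If [a <= N] and [x >= 1], the power is at most [x ^ N], while the exponential of [x] exceeds
    [x ^ (N + 1) / (N + 1)!]; the product is therefore at most [(N + 1)! / x]. *)
Lemma powR_expRN_cvg a : 0 < a -> i.+1%:R `^ a * expR (- i.+1%:R) @[i --> \oo] --> (0 : R).
Proof.
move=> a0.
have [N aN] : exists N : nat, a <= N%:R.
  by exists (Num.truncn a).+1; exact/ltW/truncnS_gt.
apply: (@squeeze_cvgr _ _ _ _ (cst 0) (fun i => (N.+1)`!%:R * i.+1%:R^-1)).
- apply: nearW => i /=; set x : R := i.+1%:R.
  have x1 : 1 <= x by rewrite ler1n.
  have x0 : 0 < x by rewrite (lt_le_trans _ x1).
  rewrite mulr_ge0 ?powR_ge0 ?expR_ge0 //= expRN ler_pdivrMr ?expR_gt0 //.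
  have h1 : x `^ a <= x ^+ N by rewrite -powR_mulrn ?(ltW x0) //; exact: ler_powR.
  apply: (le_trans h1); rewrite mulrAC ler_pdivlMr // -exprSr.
  rewrite mulrC -ler_pdivrMr ?ltr0n ?fact_gt0 //.
  by apply: le_trans (expR_ge1Dxn N (ltW x0)); rewrite lerDr.
- exact: cvg_cst.
- by rewrite -[X in _ --> X](mulr0 (N.+1)`!%:R); apply: cvgMr; exact: cvg_harmonic.
Qed.

(** Integration by parts on [[al i, be i]], then passage to the limit, in which the boundary term
    [G i] vanishes. *)
Lemma eGammaS a : 0 < a -> eGamma (a + 1) = (a%:E * eGamma a)%E.
Proof.
move=> a0.
(* The shift in [be] gives [al i <= 1 < be i], so that no interval degenerates. *)
pose al (i : nat) : R := i.+1%:R^-1; pose be (i : nat) : R := i.+2%:R.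
have al0 i : 0 < al i by rewrite invr_gt0 ltr0n.
have al1 i : al i <= 1 by rewrite invf_le1 ?ltr0n // ler1n.
have be1 i : 1 < be i by rewrite ltr1n.
have cal : al @ \oo --> (0:R) := cvg_harmonic.
have cbe : be @ \oo --> +oo.
  by have := cvg_natSy; rewrite -(cvg_shiftS (fun i => i.+1%:R : R)).
have nal : nonincreasing_seq al.
  by move=> i k ik; rewrite lef_pV2 ?posrE ?ltr0n // ler_nat ltnS.
have nbe : nondecreasing_seq be by move=> i k ik; rewrite ler_nat !ltnS.
have lim b :
   (\int[mu]_(x in `[al i, be i]) (x `^ b * expR (- x))%:E)%E @[i --> \oo] -->
  (\int[mu]_(x in `]0%R, +oo[) (x `^ b * expR (- x))%:E)%E.
  apply: cvg_integral_itv0y => // x x0; last exact: continuous_gamma_fun.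
  by rewrite mulr_ge0 ?powR_ge0 ?expR_ge0.
have L1 := lim a; have L2 := lim (a - 1).
rewrite /eGamma addrK.
pose G i : R := al i `^ a * expR (- al i) - be i `^ a * expR (- be i).
have cG : G @ \oo --> (0 : R).
  rewrite -[X in _ --> X](subr0 (0:R)); apply: cvgB.
    rewrite -[X in _ --> X](mul0r (1:R)); apply: cvgM.
      exact: (cvg_at_rightP _ _ _).1 (powR_cvg0 a0) _ (conj al0 cal).
    rewrite -[X in _ --> X](@expR0 R) -oppr0.
    apply: (@continuous_cvg _ _ _ _ _ _ (fun x : R => expR (- x))) cal.
    exact: continuous_expRN.
  have := powR_expRN_cvg a0; by rewrite -(cvg_shiftS (fun i => i.+1%:R `^ a * expR (- i.+1%:R) : R)).
have key i : ((\int[mu]_(x in `[al i, be i]) (x `^ a * expR (- x))%:E) =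
   a%:E * (\int[mu]_(x in `[al i, be i]) (x `^ (a - 1) * expR (- x))%:E) + (G i)%:E)%E.
  have albe : al i < be i by exact: le_lt_trans (al1 i) (be1 i).
  have pos x : al i <= x <= be i -> 0 < x by move=> /andP[+ _]; exact: lt_le_trans.
  have ci b : forall x, al i <= x <= be i -> {for x, continuous (fun u : R => u `^ b * expR (- u))}.
    by move=> x /pos; exact: continuous_gamma_fun.
  have ii b := continuous_integrable (ci b).
  rewrite -integralZl //; last exact: ii.
  (* [G i] is the increment over the interval of minus x^a e^(-x), hence the integral of its
     derivative. *)
  have -> : (G i)%:E = (\int[mu]_(x in `[al i, be i]) (x `^ a * expR (- x) - a * (x `^ (a - 1) * expR (- x)))%:E)%E.
    apply/esym; apply: etrans.
      apply: (@integral_FTC _ (fun x => - (x `^ a * expR (- x)))) => //; last first.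
        move=> x xx; apply: cvgB; first exact: ci.
        by apply: cvgM; [exact: cvg_cst|exact: ci].
      move=> x /pos x0.
      have := is_derive_powR a x0 => d1.
      apply: is_derive_eq.
      rewrite /GRing.scale /=.
      ring.
    by rewrite opprK addrC.
  rewrite -integralD //.
  - by apply: eq_integral => x _; rewrite -EFinM -EFinD addrC subrK.
  - by apply: (@integrableZl _ _ _ mu); [exact: measurable_itv| exact: ii].
  - apply: continuous_integrable => x xx; apply: cvgB; first exact: ci.
    by apply: cvgM; [exact: cvg_cst|exact: ci].
have L3 : (\int[mu]_(x in `[al i, be i]) (x `^ a * expR (- x))%:E)%E @[i --> \oo] -->
   (a%:E * \int[mu]_(x in `]0%R, +oo[) (x `^ (a - 1) * expR (- x))%:E)%E.
  under eq_cvg do rewrite key.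
  rewrite -[(_ * _)%E]adde0; apply: cvgeD.
  - exact: fin_num_adde_defl.
  - exact: cvgeZl.
  - by apply/fine_cvgP; split; [exact: nearW|exact: cG].
exact: (cvg_unique _ L1 L3).
Qed.

Lemma GammaS a : 0 < a -> Gamma (a + 1) = a * Gamma a.
Proof.
move=> a0; have := eGammaS a0; rewrite /eGamma /Gamma /Rintegral => ->.
(* An infinite integral stays infinite after multiplication by [a > 0], and [fine] sends it to 0, so
   the equation then reads 0 = 0. *)
case: (integral _ _ _) => [r||] //=.
- by rewrite mulr0 mulry gtr0_sg // mul1e.
- by rewrite mulr0 mulrNy gtr0_sg // mul1e.
Qed.

Lemma Gamma1 : Gamma (1 : R) = 1.
Proof.
rewrite /Gamma /Rintegral.
have -> : (\int[mu]_(x in `]0%R, +oo[) (x `^ (1 - 1) * expR (- x))%:E =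
    \int[mu]_(x in `[0%R, +oo[) (expR (- x))%:E)%E.
  rewrite -integral_itv_obnd_cbnd; last first.
    apply/measurable_EFinP; apply: (@open_continuous_measurable_fun R) => //.
    by move=> x _; exact: continuous_expRN.
  by apply: eq_integral => x _; rewrite subrr powRr0 mul1r.
rewrite (@ge0_continuous_FTC2y R _ (fun x => - expR (- x)) _ 0) //.
- by rewrite /= oppr0 expR0 opprK add0r.
- apply: continuous_subspaceT => x; exact: continuous_expRN.
- by rewrite -oppr0; apply: cvgN; exact: cvgr_expR.
- apply: cvg_at_right_filter; apply: cvgN; exact: continuous_expRN.
- move=> x _; rewrite derive1E.
  by rewrite derive_val /GRing.scale /= mulrN1 opprK.
Qed.

(** The substitution u = x^2 turns u^(-1/2) e^(-u) du into 2 e^(-x^2) dx, giving twice the Gaussian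
    integral over the half-line. It is carried out on compact intervals, away from the singularity
    at 0. *)
Lemma Gamma12 : Gamma (2^-1 : R) = Num.sqrt pi.
Proof.
pose al (i : nat) : R := i.+1%:R^-1; pose be (i : nat) : R := i.+2%:R.
have al0 i : 0 < al i by rewrite invr_gt0 ltr0n.
have al1 i : al i <= 1 by rewrite invf_le1 ?ltr0n // ler1n.
have be1 i : 1 < be i by rewrite ltr1n.
have cal : al @ \oo --> (0:R) := cvg_harmonic.
have cbe : be @ \oo --> +oo.
  by have := cvg_natSy; rewrite -(cvg_shiftS (fun i => i.+1%:R : R)).
have nal : nonincreasing_seq al.
  by move=> i k ik; rewrite lef_pV2 ?posrE ?ltr0n // ler_nat ltnS.
have nbe : nondecreasing_seq be by move=> i k ik; rewrite ler_nat !ltnS.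
pose G (u : R) := u `^ (2^-1 - 1) * expR (- u).
have L1 : (\int[mu]_(x in `[((al i) ^+ 2)%R, ((be i) ^+ 2)%R]) (G x)%:E)%E @[i --> \oo] -->
    (\int[mu]_(x in `]0%R, +oo[) (G x)%:E)%E.
  apply: cvg_integral_itv0y.
  - by move=> x x0; rewrite mulr_ge0 ?powR_ge0 ?expR_ge0.
  - by move=> x x0; exact: continuous_gamma_fun.
  - by move=> i; rewrite exprn_gt0.
  - by move=> i k ik; rewrite ler_sqr ?nnegrE ?(ltW (al0 _)) //; exact: nal.
  - move=> i k ik; rewrite ler_sqr ?nnegrE ?(ltW (lt_trans ltr01 (be1 _))) //.
    exact: nbe.
  - by rewrite -[X in _ --> X](mul0r (0:R)); apply: cvgM.
  - by apply: (cvg_comp be (fun x => x ^+ 2) cbe); exact: cvgr_expr2.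
have L2 : (\int[mu]_(x in `[al i, be i]) (gauss_fun x)%:E)%E @[i --> \oo] -->
    (\int[mu]_(x in `]0%R, +oo[) (gauss_fun x)%:E)%E.
  apply: cvg_integral_itv0y => //.
  - by move=> x x0; exact: gauss_fun_ge0.
  - by move=> x x0; exact: continuous_gauss_fun.
have key i : ((\int[mu]_(x in `[((al i) ^+ 2)%R, ((be i) ^+ 2)%R]) (G x)%:E) =
    2%:E * (\int[mu]_(x in `[al i, be i]) (gauss_fun x)%:E))%E.
  have albe : al i < be i by exact: le_lt_trans (al1 i) (be1 i).
  have DF : (fun x : R => x ^+ 2)^`()%classic = (fun x => 2 * x).
    apply/funext => x; rewrite derive1E exp_derive /GRing.scale /= expr1 mulr1.
    by rewrite mulr_natl.
  have cF' : continuous (fun x : R => 2 * x).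
    by move=> x; apply: cvgM; [exact: cvg_cst|exact: cvg_id].
  have cF : continuous (fun x : R => x ^+ 2) := @exprn_continuous R 2.
  rewrite (@integration_by_substitution_increasing R (fun x => x ^+ 2)) ?DF.
  - rewrite -integralZl //; last first.
      by apply: continuous_integrable => x _; exact: continuous_gauss_fun.
    apply: eq_integral => x; rewrite inE /= in_itv /= => /andP[ax _].
    have x0 : 0 < x by exact: lt_le_trans ax.
    rewrite -EFinM /G /gauss_fun /=; congr EFin.
    change ((x ^+ 2) `^ (2^-1 - 1) * expR (- x ^+ 2) * (2 * x) = 2 * expR (- x ^+ 2)).
    have -> : (x ^+ 2) `^ (2^-1 - 1) = x^-1.
      rewrite -powR_mulrn ?(ltW x0) // -powRrM.
      have -> : 2%:R * (2^-1 - 1) = -1 :> R by field.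
      by rewrite powR_inv1 ?(ltW x0).
    by field; rewrite gt_eqF.
  - exact: ltW.
  - move=> x y; rewrite !in_itv /= => /andP[ax _] /andP[ay _] xy.
    by rewrite ltr_sqr ?nnegrE ?(le_trans (ltW (al0 i))).
  - by move=> x _; exact: cF'.
  - by apply: cvgP; apply: cvg_at_right_filter; exact: cF'.
  - by apply: cvgP; apply: cvg_at_left_filter; exact: cF'.
  - split.
    + by move=> x _; exact: exprn_derivable.
    + by apply: cvg_at_right_filter; exact: cF.
    + by apply: cvg_at_left_filter; exact: cF.
  - apply/subspace_continuousP => x /=; rewrite in_itv /= => /andP[ax _].
    apply: cvg_within_filter; apply: continuous_gamma_fun.
    by apply: lt_le_trans ax; rewrite exprn_gt0.
have L3 : (\int[mu]_(x in `[((al i) ^+ 2)%R, ((be i) ^+ 2)%R]) (G x)%:E)%E @[i --> \oo] -->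
    (2%:E * \int[mu]_(x in `]0%R, +oo[) (gauss_fun x)%:E)%E.
  by under eq_cvg do rewrite key; exact: cvgeZl.
rewrite /Gamma /Rintegral (cvg_unique _ L1 L3) //.
rewrite integral_itv_obnd_cbnd; last first.
  by apply/measurable_EFinP/measurable_funTS; exact: measurable_gauss_fun.
by rewrite integral0y_gauss /= mulrC divfK.
Qed.

(** The functional equation moves the argument by two half-integer steps, hence an induction on
    consecutive pairs starting from 1/2 and 1. *)
Lemma Gamma_gt0_half m : 0 < Gamma (m.+1%:R / 2 : R).
Proof.
have [] : 0 < Gamma (m.+1%:R / 2 : R) /\ 0 < Gamma (m.+2%:R / 2 : R); last by [].
elim: m => [|m [IH1 IH2]].
  by rewrite divff // mul1r Gamma1 Gamma12 sqrtr_gt0 pi_gt0 ltr01.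
split => //.
have -> : m.+3%:R / 2 = m.+1%:R / 2 + 1 :> R.
  by rewrite -addn2 natrD mulrDl divff.
by rewrite GammaS ?mulr_gt0 // ?invr_gt0 ltr0n.
Qed.

End gamma.

(** * Moments of the Gegenbauer weight *)

Section weight.
Context {R : realType}.
Notation mu := (@lebesgue_measure R).

(** Angles increasing to [pi / 2]. Their sines exhaust []-1, 1[] by compact intervals on which the
    weight is smooth even for [n = 2], and whose endpoints have explicit arcsines. *)
Definition angle (i : nat) : R := pi / 2 - pi / 2 / i.+2%:R.
Definition sn i : R := sin (angle i).

Lemma angle_bounds i : 0 < angle i < pi / 2.
Proof.
have p0 : 0 < pi / 2 :> R by rewrite divr_gt0 ?pi_gt0.
rewrite /angle gtrDl oppr_lt0 divr_gt0 ?ltr0n // andbT subr_gt0.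
by rewrite ltr_pdivrMr ?ltr0n // ltr_pMr // ltr1n.
Qed.

Lemma angle_itv i : angle i \in `[(- (pi / 2)), (pi / 2)].
Proof.
have /andP[h1 h2] := angle_bounds i.
by rewrite in_itv /= (ltW h2) andbT; lra.
Qed.

Lemma angle_nd : nondecreasing_seq angle.
Proof.
move=> i k ik; rewrite /angle lerD2l lerN2 ler_pM2l; last first.
  by rewrite divr_gt0 ?pi_gt0.
by rewrite lef_pV2 ?posrE ?ltr0n // ler_nat !ltnS.
Qed.

Lemma cvg_angle : angle @ \oo --> (pi / 2 : R).
Proof.
rewrite -[X in _ --> X](subr0 (pi / 2 : R)) -(mulr0 (pi / 2 : R)).
apply: cvgB; first exact: cvg_cst.
apply: cvgM; first exact: cvg_cst.
by have := @cvg_harmonic R; rewrite -(cvg_shiftS (fun i => i.+1%:R^-1 : R)).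
Qed.

Lemma pihalf_itv : pi / 2 \in (`[(- (pi / 2)), (pi / 2)] : interval R).
Proof. by rewrite in_itv /= lexx andbT; have := @pi_gt0 R; lra. Qed.

Lemma sn_gt0 i : 0 < sn i.
Proof. exact: sin_gt0_pihalf (angle_bounds i). Qed.

Lemma sn_lt1 i : sn i < 1.
Proof.
rewrite -sin_pihalf ltr_sin ?angle_itv ?pihalf_itv //.
by have /andP[] := angle_bounds i.
Qed.

Lemma sn_nd : nondecreasing_seq sn.
Proof.
move=> i k /angle_nd; rewrite le_eqVlt => /predU1P[h|h]; first by rewrite /sn h.
by apply/ltW; rewrite ltr_sin ?angle_itv.
Qed.

Lemma cvg_sn : sn @ \oo --> (1 : R).
Proof.
rewrite -sin_pihalf; apply: continuous_cvg cvg_angle.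
exact: continuous_sin.
Qed.

Lemma bigcup_sn : \bigcup_i [set` `[- sn i, sn i]] = `]-1, 1[%classic :> set R.
Proof.
apply/seteqP; split => x /=.
  move=> [i _] /=; rewrite !in_itv /= => /andP[h1 h2].
  by have := sn_lt1 i => h3; apply/andP; split; lra.
rewrite in_itv /= => /andP[h1 h2].
have [i _ hi] : \forall i \near \oo, `|x| < sn i.
  by apply: cvgr_gt cvg_sn _ _; rewrite ltr_norml h1.
by exists i => //=; rewrite in_itv /= -ler_norml ltW // hi /=.
Qed.

Definition weight n (t : R) : R := (1 - t ^+ 2) `^ ((n%:R - 3) / 2).

Lemma continuous_weight n x : -1 < x < 1 -> {for x, continuous (weight n)}.
Proof.
move=> /andP[x1 x2]; rewrite /weight.
apply: (@continuous_comp _ _ _ (fun t : R => 1 - t ^+ 2) (fun u => u `^ _)).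
  by apply: cvgB; [exact: cvg_cst|exact: exprn_continuous].
by apply: continuous_powR; nra.
Qed.

Lemma measurable_weight n D : measurable_fun D (weight n).
Proof.
apply: measurable_funTS; rewrite /weight.
apply: (measurableT_comp (measurable_powR _)).
by apply: measurable_funB => //; exact: measurable_funX.
Qed.

Lemma weight_ge0 n x : 0 <= weight n x.
Proof. exact: powR_ge0. Qed.

(** For [n = 2] the weight is the derivative of the arcsine, so the integral up to [sn i] is twice
    [angle i], which tends to [pi]. *)
Lemma integral_weight2 : (\int[mu]_(x in `](-1)%R, 1%R[) (weight 2 x)%:E = pi%:E)%E.
Proof.
rewrite -bigcup_sn.
have L : (\int[mu]_(x in `[(- sn i)%R, sn i]) (weight 2 x)%:E)%E @[i --> \oo] -->
    (\int[mu]_(x in \bigcup_i [set` `[(- sn i)%R, sn i]]) (weight 2 x)%:E)%E.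
  apply: ge0_nondecreasing_set_cvg_integral => //.
  - move=> i k ik; rewrite subsetEset => x /=; rewrite !in_itv /= => /andP[ax xb].
    by have := sn_nd ik => h; apply/andP; split; lra.
  - by move=> i; apply/measurable_EFinP; exact: measurable_weight.
  - by move=> i x _; rewrite lee_fin weight_ge0.
have L2 : (angle i *+ 2)%:E @[i --> \oo] --> (pi%:E : \bar R).
  apply/fine_cvgP; split; first exact: nearW.
  have -> : pi = (pi / 2) *+ 2 :> R by rewrite -mulr_natr divfK.
  by apply: cvgMn; exact: cvg_angle.
apply: (cvg_unique _ L) => //.
suff -> : (fun i => \int[mu]_(x in `[(- sn i)%R, sn i]) (weight 2 x)%:E)%E =
    (fun i => (angle i *+ 2)%:E) by [].
apply/funext => i.
have xb x : - sn i <= x <= sn i -> -1 < x < 1.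
  by have := sn_lt1 i => h /andP[h1 h2]; apply/andP; split; lra.
apply: etrans.
  apply: (@integral_FTC R (@asin R)).
  - by have := sn_gt0 i; lra.
  - move=> x /xb x1; have := is_derive1_asin x1.
    rewrite /weight (_ : (2%:R - 3) / 2 = - 2^-1) ?powRN ?powR12_sqrt //; last by field.
    by move: x1 => /andP[]; nra.
  - by move=> x /xb; exact: continuous_weight.
rewrite /sn -sinN !sinK ?angle_itv //.
  by rewrite opprK mulr2n.
have := angle_itv i; rewrite !in_itv /= => /andP[h1 h2]; apply/andP; split; lra.
Qed.

(** On the open interval the base [1 - t ^ 2] lies in []0, 1]], so a larger exponent gives a smaller
    weight: the case [n = 2], of integral [pi], dominates all others. *)
Lemma integrable_weight n : (2 <= n)%N -> mu.-integrable `[-1, 1] (EFin \o weight n).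
Proof.
move=> n2; apply/integrableP; split.
  by apply/measurable_EFinP; exact: measurable_weight.
rewrite integral_itv_bndoo; last first.
  by apply: measurableT_comp => //; apply/measurable_EFinP; exact: measurable_weight.
apply: (@le_lt_trans _ _ pi%:E); last exact: ltry.
rewrite -integral_weight2; apply: ge0_le_integral => //.
- by apply: measurableT_comp => //; apply/measurable_EFinP; exact: measurable_weight.
- by apply/measurable_EFinP; exact: measurable_weight.
move=> x /=; rewrite in_itv /= => /andP[x1 x2].
rewrite lee_fin ger0_norm ?weight_ge0 //.
apply: ger_powR; first by apply/andP; split; nra.
by rewrite ler_pM2r ?invr_gt0 // lerD2r ler_nat.
Qed.

Lemma integrable_mono_weight n k : (2 <= n)%N ->
  mu.-integrable `[-1, 1] (fun x => (x ^+ k * weight n x)%:E).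
Proof.
move=> n2.
rewrite (_ : (fun _ => _) = ((EFin \o (fun x : R => x ^+ k)%R) \* (EFin \o weight n))%E) //.
apply: integrableMr => //.
- exists 1; split; first exact: num_real.
  move=> y y1 x /=; rewrite in_itv /= => xx.
  rewrite normrX (le_trans _ (ltW y1)) // exprn_ile1 // ler_norml //.
- exact: integrable_weight.
Qed.

Lemma integrableZ_mono_weight n k c : (2 <= n)%N ->
  mu.-integrable `[-1, 1] (fun x => (c * (x ^+ k * weight n x))%:E).
Proof.
move=> n2.
rewrite (_ : (fun _ => _) = (fun x : R => c%:E * ((x ^+ k * weight n x)%R)%:E)%E) //.
by apply: integrableZl => //; exact: integrable_mono_weight.
Qed.

Definition wmoment n k : R := \int[mu]_(x in `[-1, 1]) (x ^+ k * weight n x).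

Lemma cvg_integral_sn (f : R -> R) : mu.-integrable `[-1, 1] (EFin \o f) ->
  \int[mu]_(x in `[- sn i, sn i]) f x @[i --> \oo] --> \int[mu]_(x in `[-1, 1]) f x.
Proof.
move=> fi.
have sub : `]-1, 1[ `<=` (`[-1, 1] : set R) by exact: subset_itv_oo_cc.
have fi2 : mu.-integrable `]-1, 1[ (EFin \o f) by exact: integrableS fi.
apply: fine_cvg; rewrite fineK; last exact: integrable_fin_num.
rewrite integral_itv_bndoo; last exact: measurable_int fi2.
rewrite -bigcup_sn; apply: cvg_integral_bigcup => //.
- move=> i k ik; rewrite subsetEset => x /=; rewrite !in_itv /= => /andP[ax xb].
  by have := sn_nd ik => h; apply/andP; split; lra.
- by rewrite bigcup_sn.
Qed.

(** With [c = (n - 1) / 2], the derivative of [F], that is t^r (1 - t^2)^c, is the difference [f] of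
    the two weighted monomials. As [c > 0], [F] tends to 0 at both endpoints, so the integral of [f]
    is 0. *)
Lemma wmoment_rec n r : (2 <= n)%N ->
  r%:R * wmoment n r.-1 = (n%:R - 1 + r%:R) * wmoment n r.+1.
Proof.
move=> n2.
pose c : R := (n%:R - 1) / 2.
have n2R : 2 <= n%:R :> R by rewrite ler_nat.
have c0 : 0 < c by rewrite /c; lra.
have cE : (n%:R - 3) / 2 = c - 1 :> R by rewrite /c; field.
pose F (t : R) := t ^+ r * (1 - t ^+ 2) `^ c.
pose f (t : R) := r%:R * (t ^+ r.-1 * weight n t) - (n%:R - 1 + r%:R) * (t ^+ r.+1 * weight n t).
have fE : \int[mu]_(x in `[-1, 1]) f x =
    r%:R * wmoment n r.-1 - (n%:R - 1 + r%:R) * wmoment n r.+1.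
  rewrite RintegralB //=.
  - by rewrite !RintegralZl //; exact: integrable_mono_weight.
  - exact: integrableZ_mono_weight.
  - exact: integrableZ_mono_weight.
have fi : mu.-integrable `[-1, 1] (EFin \o f).
  apply: (@integrableB _ _ _ mu _ _ (fun x => (r%:R * (x ^+ r.-1 * weight n x))%:E) (fun x => ((n%:R - 1 + r%:R) * (x ^+ r.+1 * weight n x))%:E)) => //.
  - exact: integrableZ_mono_weight.
  - exact: integrableZ_mono_weight.
have L := cvg_integral_sn fi.
apply/eqP; rewrite -subr_eq0 -fE; apply/eqP.
apply: (cvg_unique _ L) => //.
have -> : (fun i => \int[mu]_(x in `[- sn i, sn i]) f x) = (fun i => F (sn i) - F (- sn i)).
  apply/funext => i; rewrite /Rintegral.
  have xb x : - sn i <= x <= sn i -> -1 < x < 1.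
    by have := sn_lt1 i => h /andP[h1 h2]; apply/andP; split; lra.
  rewrite (_ : integral _ _ _ = (F (sn i) - F (- sn i))%:E) //.
  apply: integral_FTC.
  - by have := sn_gt0 i; lra.
  - move=> x /xb /andP[x1 x2].
    have u0 : 0 < 1 - x ^+ 2 by nra.
    have d1 := is_derive_powR c u0.
    have d2 : is_derive x 1 (fun t : R => 1 - t ^+ 2) (- (2 * x)).
      by apply: is_derive_eq; rewrite /GRing.scale /=; ring.
    have d3 := @is_derive1_comp R (fun u : R => u `^ c) (fun t => 1 - t ^+ 2) x _ _ d1 d2.
    rewrite /F; have d4 : is_derive x 1 (fun t : R => t ^+ r) (r%:R * x ^+ r.-1).
      by rewrite -[X in is_derive _ _ _ X]mulr1; apply: is_derive_exprn.
    have d5 := is_deriveM d4 d3.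
    apply: (is_derive_eq d5).
    rewrite /f /weight /GRing.scale /= cE.
    have -> : (1 - x ^+ 2) `^ c = (1 - x ^+ 2) * (1 - x ^+ 2) `^ (c - 1).
      by rewrite mulr_powRB1 // ltW.
    have -> : n%:R = c * 2 + 1 :> R by rewrite /c; field.
    (* For [r = 0] the truncated exponent [r.-1] is 0, but its coefficient vanishes. *)
    case: (r) => [|q] /=; first by rewrite expr0 expr1; ring.
    by rewrite !exprS; ring.
  - move=> x /xb x1; apply: cvgB; apply: cvgM; try exact: cvg_cst; apply: cvgM;
      try exact: continuous_weight; exact: exprn_continuous.
have P0 : (1 - sn i ^+ 2) `^ c @[i --> \oo] --> (0 : R).
  apply: (cvg_at_rightP _ _ _).1 (powR_cvg0 c0) (fun i => 1 - sn i ^+ 2) _; split.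
    by move=> i; have := sn_lt1 i; have := sn_gt0 i; nra.
  rewrite -[X in _ --> X](subrr (1:R)) -[X in _ - X](expr1n R 2).
  apply: cvgB; first exact: cvg_cst.
  by apply: (@continuous_cvg _ _ _ _ _ _ (fun x : R => x ^+ 2)) cvg_sn; exact: exprn_continuous.
change (F (sn i) - F (- sn i) @[i --> \oo] --> (0 : R)).
rewrite -[X in _ --> X](subrr (0:R)) /F; apply: cvgB.
  rewrite -[X in _ --> X](mulr0 ((1:R) ^+ r)); apply: cvgM => //.
  by apply: (@continuous_cvg _ _ _ _ _ _ (fun x : R => x ^+ r)) cvg_sn; exact: exprn_continuous.
rewrite -[X in _ --> X](mulr0 ((-1:R) ^+ r)); apply: cvgM => //.
  apply: (@continuous_cvg _ _ _ _ _ _ (fun x : R => (- x) ^+ r)) cvg_sn.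
  apply: (@continuous_comp _ _ _ -%R (fun x : R => x ^+ r)).
    exact: opp_continuous.
  exact: exprn_continuous.
by under eq_cvg do rewrite sqrrN.
Qed.

(** Raising the dimension by 2 multiplies the weight by [1 - t ^ 2]. *)
Lemma wmoment_add2 n : (2 <= n)%N -> wmoment n.+2 0 = wmoment n 0 - wmoment n 2.
Proof.
move=> n2; rewrite /wmoment -RintegralB //; try exact: integrable_mono_weight.
apply: eq_Rintegral => x; rewrite inE /= in_itv /= => /andP[x1 x2].
rewrite !expr0 !mul1r -[X in X - _]mul1r -mulrBl /weight.
have -> : (n%:R - 3) / 2 = (n.+2%:R - 3) / 2 - 1 :> R.
  by rewrite -[n.+2]addn2 natrD; field.
rewrite mulr_powRB1 //; first by nra.
rewrite divr_gt0 // subr_gt0 -[n.+2]addn2 natrD.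
by have : 2 <= n%:R :> R by [rewrite ler_nat]; lra.
Qed.

Lemma wmoment20 : wmoment 2 0 = pi.
Proof.
rewrite /wmoment /Rintegral.
under eq_integral do rewrite expr0 mul1r.
rewrite integral_itv_bndoo ?integral_weight2 //.
by apply/measurable_EFinP; exact: measurable_weight.
Qed.

Lemma wmoment30 : wmoment 3 0 = 2.
Proof.
rewrite /wmoment.
under eq_Rintegral do rewrite expr0 mul1r /weight subrr mul0r powRr0.
rewrite Rintegral_cst //= lebesgue_measure_itv /= ifT /=; last first.
  by rewrite lte_fin; lra.
by rewrite mul1r opprK.
Qed.

(** Induction in steps of 2 from [n = 2] and [n = 3]: passing from [n] to [n + 2] multiplies the
    total weight by [(n - 1) / n], and [cn] by the inverse factor through the functional equation of
    Gamma. *)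
Lemma cn_wmoment n : (2 <= n)%N -> cn R n * wmoment n 0 = 1.
Proof.
move=> n2; rewrite -(subnK n2); move: (n - 2)%N => {n n2} p; rewrite addn2.
suff [] : cn R p.+2 * wmoment p.+2 0 = 1 /\ cn R p.+3 * wmoment p.+3 0 = 1 by [].
have spi : Num.sqrt pi != 0 :> R by rewrite gt_eqF // sqrtr_gt0 pi_gt0.
elim: p => [|p [IH1 IH2]].
  rewrite wmoment20 wmoment30 /cn; split.
    rewrite divff // Gamma1 (_ : (2 - 1) / 2 = 2^-1 :> R) ?Gamma12; last by field.
    by rewrite -{3}(sqr_sqrtr (ltW (pi_gt0 R))); field.
  have -> : (3 - 1) / 2 = 1 :> R by field.
  have -> : 3 / 2 = 2^-1 + 1 :> R by field.
  rewrite GammaS ?invr_gt0 // Gamma1 Gamma12; by field.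
split => //.
have [g1 g2] : 0 < Gamma ((p.+2%:R - 1) / 2 : R) /\ 0 < Gamma (p.+2%:R / 2 : R).
  split; last exact: Gamma_gt0_half.
  by rewrite -[p.+2]addn1 natrD addrK; exact: Gamma_gt0_half.
have rec := @wmoment_rec p.+2 1 isT.
rewrite wmoment_add2 //.
have p0 : p.+2%:R != 0 :> R by rewrite pnatr_eq0.
have p1 : p.+2%:R - 1 != 0 :> R.
  by rewrite -[p.+2]addn1 natrD addrK pnatr_eq0.
have p0' : 2 + p%:R != 0 :> R by rewrite -natrD pnatr_eq0.
have p1' : 2 + p%:R - 1 != 0 :> R by rewrite -natrD.
(* The recursion at [r = 1] expresses the second moment as the total weight divided by the
   dimension. *)
have -> : wmoment p.+2 2 = wmoment p.+2 0 / p.+2%:R.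
  by move: rec; rewrite mul1r subrK => ->; rewrite mulrAC mulfV ?mul1r.
have cE : cn R p.+4 = p.+2%:R / (p.+2%:R - 1) * cn R p.+2.
  rewrite /cn -[p.+4]addn2 natrD.
  have -> : (p.+2%:R + 2) / 2 = p.+2%:R / 2 + 1 :> R by field.
  have -> : (p.+2%:R + 2 - 1) / 2 = (p.+2%:R - 1) / 2 + 1 :> R by field.
  rewrite !GammaS.
  - by field; rewrite p1' spi !gt_eqF.
  - by rewrite divr_gt0 // -[p.+2]addn1 natrD addrK ltr0n.
  - by rewrite divr_gt0 // ltr0n.
rewrite cE -[RHS]IH1; by field; rewrite ?p1' ?p0'.
Qed.
End weight.

(** * Invariant measures on the sphere *)

Lemma continuous_bigsum {R : realType} (T : topologicalType) (I : Type) (r : seq I)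
    (F : I -> T -> R) :
  (forall i, continuous (F i)) -> continuous (fun x => \sum_(i <- r) F i x).
Proof.
move=> cF; elim: r => [|i r IH] x.
  rewrite (_ : (fun _ => _) = cst 0); first exact: cvg_cst.
  by apply/funext => z; rewrite big_nil.
rewrite (_ : (fun _ => _) = (fun x => F i x + \sum_(j <- r) F j x)); last first.
  by apply/funext => z; rewrite big_cons.
by apply: cvgD; [exact: cF|exact: IH].
Qed.

Lemma continuous_mulf {R : realType} (T : topologicalType) (f g : T -> R) :
  continuous f -> continuous g -> continuous (fun x => f x * g x).
Proof. by move=> cf cg x; apply: cvgM; [exact: cf|exact: cg]. Qed.

Lemma continuous_cstf {R : realType} (T : topologicalType) (c : R) :
  continuous (fun _ : T => c).
Proof. by move=> x; exact: cvg_cst. Qed.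

Lemma nbhs_forall2 (T : topologicalType) (I J : finType) (Q : I -> J -> set T) (x : T) :
  (forall i j, nbhs x (Q i j)) -> nbhs x [set z | forall i j, Q i j z].
Proof.
by move=> h; apply: filter_forall => i; apply: filter_forall => j; exact: h.
Qed.

Section dot.
Context {R : realType} {n : nat}.
Implicit Types (x y z : 'rV[R]_n) (U V : 'M[R]_n).

Lemma dotE x y : dot x y = (x *m y^T) ord0 ord0.
Proof. by rewrite mxE; apply: eq_bigr => i _; rewrite mxE. Qed.

Lemma dotDl x y z : dot (x + y) z = dot x z + dot y z.
Proof. by rewrite !dotE mulmxDl mxE. Qed.

Lemma dotZl c x z : dot (c *: x) z = c * dot x z.
Proof. by rewrite !dotE -scalemxAl mxE. Qed.

Lemma dot_orthogonal U x : U *m U^T = 1%:M -> dot (x *m U) (x *m U) = dot x x.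
Proof. by move=> UU; rewrite !dotE trmx_mul mulmxA -(mulmxA x) UU mulmx1. Qed.

Lemma sphere_orthogonal U x : U *m U^T = 1%:M ->
  @sphere R n (x *m U) <-> @sphere R n x.
Proof. by move=> UU; rewrite /sphere /= dot_orthogonal. Qed.

Lemma sphere_coord_le1 x i : @sphere R n x -> `|x ord0 i| <= 1.
Proof.
rewrite /sphere /= /dot => xx.
have : x ord0 i ^+ 2 <= 1.
  rewrite -xx (bigD1 i) //= -expr2 lerDl; apply: sumr_ge0 => j _.
  by rewrite -expr2 sqr_ge0.
by rewrite -real_normK ?num_real // -[leRHS](expr1n R 2) ler_sqr // nnegrE.
Qed.

(** A neighbourhood of a matrix contains a box of neighbourhoods of its entries, so continuity is
    checked entry by entry, where the map is a finite sum of coordinates times constants. *)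
Lemma mulmxr_continuous U : continuous (fun x : 'rV[R]_n => x *m U).
Proof.
move=> x A [P xP PA].
have coordc i j : continuous (fun z : 'rV[R]_n => (z *m U) i j).
  rewrite (_ : (fun z => _) = (fun z : 'rV[R]_n => \sum_k z i k * U k j)); last first.
    by apply/funext => w; rewrite mxE.
  apply: continuous_bigsum => k; apply: continuous_mulf.
    exact: coord_continuous.
  exact: continuous_cstf.
have := nbhs_forall2 (fun i j => coordc i j x _ (xP i j)).
by apply: filterS => z; exact: PA.
Qed.

End dot.

Section borel.
Context {R : realType} {n : nat}.

Lemma continuous_borel_measurable (f : 'rV[R]_n -> R) : continuous f ->
  measurable_fun [set: borel R n] (f : borel R n -> R).
Proof.
move=> cf; apply: (measurability _ (RGenOpens.measurableE R)).
move=> _ [_ [a [b ->] <-]]; rewrite setTI; apply: sub_sigma_algebra.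
by apply: open_comp => // ? _; exact: cf.
Qed.

Lemma measurable_mulmxr (U : 'M[R]_n) :
  measurable_fun [set: borel R n] ((fun x : 'rV[R]_n => x *m U) : borel R n -> borel R n).
Proof.
apply: (@measurability _ _ (borel R n) (borel R n) setT _ (@open 'rV[R]_n) erefl).
move=> _ [B oB <-]; rewrite setTI; apply: sub_sigma_algebra.
by apply: open_comp => // ? _; exact: mulmxr_continuous.
Qed.

Lemma measurable_coord i :
  measurable_fun [set: borel R n] ((fun x : 'rV[R]_n => x ord0 i) : borel R n -> R).
Proof. by apply: continuous_borel_measurable; exact: coord_continuous. Qed.

Lemma measurable_sphere : measurable (@sphere R n : set (borel R n)).
Proof.
have m : measurable_fun [set: borel R n] ((fun x : 'rV[R]_n => dot x x) : borel R n -> R).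
  apply: continuous_borel_measurable; apply: continuous_bigsum => i.
  by apply: continuous_mulf; exact: coord_continuous.
by rewrite -[X in measurable X]setTI; apply: (m _ [set 1]).
Qed.

End borel.

(** * Measurable functions bounded on the sphere *)

Section sphere_functions.
Context {R : realType} {n : nat}.

(** Measurability is asked on the whole space but boundedness only on the sphere, as polynomials are
    unbounded elsewhere. The class is stable under sums, products and orthogonal maps, and its
    members are integrable for [sigma]. *)
Definition sbounded (f : borel R n -> R) :=
  measurable_fun [set: borel R n] f /\
  exists M : R, forall x, @sphere R n x -> `|f x| <= M.

Lemma sbounded_cst c : sbounded (cst c).
Proof. by split; [exact: measurable_cst|exists `|c|]. Qed.

Lemma sbounded_coord i : sbounded (fun x : 'rV[R]_n => x ord0 i).
Proof.
split; first exact: measurable_coord.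
by exists 1 => x; exact: sphere_coord_le1.
Qed.

Lemma sboundedD f g : sbounded f -> sbounded g -> sbounded (fun x => f x + g x).
Proof.
move=> [mf [M fM]] [mg [N gN]]; split; first exact: measurable_funD.
by exists (M + N) => x Sx; apply: le_trans (ler_normD _ _) _; apply: lerD; auto.
Qed.

Lemma sboundedM f g : sbounded f -> sbounded g -> sbounded (fun x => f x * g x).
Proof.
move=> [mf [M fM]] [mg [N gN]]; split; first exact: measurable_funM.
by exists (M * N) => x Sx; rewrite normrM ler_pM //; auto.
Qed.

Lemma sboundedZ c f : sbounded f -> sbounded (fun x => c * f x).
Proof. by apply: sboundedM; exact: sbounded_cst. Qed.

Lemma sboundedX f k : sbounded f -> sbounded (fun x => f x ^+ k).
Proof.
move=> bf; elim: k => [|k IH]; first exact: sbounded_cst.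
by under eq_fun do rewrite exprS; exact: sboundedM.
Qed.

Lemma sbounded_sum I (r : seq I) (F : I -> borel R n -> R) :
  (forall i, sbounded (F i)) -> sbounded (fun x => \sum_(i <- r) F i x).
Proof.
move=> bF; elim: r => [|i r IH].
  by under eq_fun do rewrite big_nil; exact: sbounded_cst.
by under eq_fun do rewrite big_cons; exact: sboundedD.
Qed.

Lemma sbounded_dot (y : 'rV[R]_n) : sbounded (fun x : 'rV[R]_n => dot x y).
Proof.
apply: sbounded_sum => i; apply: sboundedM; first exact: sbounded_coord.
exact: sbounded_cst.
Qed.

Lemma sbounded_mulmxr (U : 'M[R]_n) f : U *m U^T = 1%:M -> sbounded f ->
  sbounded (fun x : 'rV[R]_n => f (x *m U)).
Proof.
move=> UU [mf [M fM]]; split.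
  exact: measurableT_comp mf (measurable_mulmxr U).
by exists M => x Sx; apply: fM; apply/sphere_orthogonal.
Qed.

End sphere_functions.

Section expectation.
Context {R : realType} {n : nat} (sigma : probability (borel R n) R).
Hypothesis hsigma : is_sphere_measure sigma.

Definition sE (f : borel R n -> R) : R := \int[sigma]_(x in @sphere R n) f x.

Lemma sbounded_integrable f : sbounded f ->
  sigma.-integrable (@sphere R n) (EFin \o f).
Proof.
move=> [mf [M fM]]; apply: measurable_bounded_integrable.
- exact: measurable_sphere.
- exact: le_lt_trans (probability_le1 _ measurable_sphere) (ltry 1).
- exact: measurable_funTS.
- exists M; split; first exact: num_real.
  by move=> z Mz x Sx; apply: le_trans (fM x Sx) (ltW Mz).
Qed.

Lemma sE_cst c : sE (cst c) = c.
Proof.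
rewrite /sE Rintegral_cst; last exact: measurable_sphere.
by case: hsigma => h _; rewrite [X in fine X]h /= mulr1.
Qed.

Lemma sED f g : sbounded f -> sbounded g -> sE (fun x => f x + g x) = sE f + sE g.
Proof.
by move=> bf bg; apply: RintegralD; [exact: measurable_sphere|exact: sbounded_integrable..].
Qed.

Lemma sEZ c f : sbounded f -> sE (fun x => c * f x) = c * sE f.
Proof.
by move=> bf; apply: RintegralZl; [exact: measurable_sphere|exact: sbounded_integrable].
Qed.

Lemma sE_sum I (r : seq I) (F : I -> borel R n -> R) :
  (forall i, sbounded (F i)) ->
  sE (fun x => \sum_(i <- r) F i x) = \sum_(i <- r) sE (F i).
Proof.
move=> bF; elim: r => [|i r IH].
  by rewrite big_nil -[RHS]sE_cst; congr sE; apply/funext => x; rewrite big_nil.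
rewrite big_cons -IH -sED //; last exact: sbounded_sum.
by congr sE; apply/funext => x; rewrite big_cons.
Qed.

Lemma eq_sE f g : (forall x, @sphere R n x -> f x = g x) -> sE f = sE g.
Proof. by move=> fg; apply: eq_Rintegral => x; rewrite inE; exact: fg. Qed.

(** Change of variables: the image of [sigma] under right multiplication by [U] is [sigma] by
    invariance, and the sphere is its own preimage. *)
Lemma sE_rot (U : 'M[R]_n) f : U *m U^T = 1%:M -> \det U = 1 -> sbounded f ->
  sE (fun x : 'rV[R]_n => f (x *m U)) = sE f.
Proof.
move=> UU dU bf.
pose phi : borel R n -> borel R n := fun x : 'rV[R]_n => x *m U.
have mphi : measurable_fun setT phi := measurable_mulmxr U.
have preS : phi @^-1` (@sphere R n) = @sphere R n.
  by apply/seteqP; split => x /=; move/(sphere_orthogonal _ UU).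
rewrite /sE /Rintegral; congr fine.
have mf : measurable_fun [set: borel R n] (EFin \o f).
  by apply/measurable_EFinP; case: bf.
have := @integral_pushforward _ _ _ _ R phi mphi sigma (@sphere R n) (EFin \o f) mf.
rewrite preS => /(_ (sbounded_integrable (sbounded_mulmxr UU bf)) measurable_sphere) <-.
apply: eq_measure_integral => A mA _.
by case: hsigma => _ /(_ U A UU dU mA).
Qed.

End expectation.

(** * Rotations in a coordinate plane *)

Section rotations.
Context {R : realType} {n : nat} (a b : 'I_n) (ab : a != b).
Implicit Types (c s : R).

(** [planeP] projects onto the plane of the coordinates [a] and [b], and [planeJ] is the quarter
    turn in it, extended by 0. They multiply like the complex numbers 1 and i. *)
Definition planeP : 'M[R]_n := delta_mx a a + delta_mx b b.
Definition planeJ : 'M[R]_n := delta_mx a b - delta_mx b a.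
Definition plane_rot c s : 'M[R]_n := 1%:M + (c - 1) *: planeP + s *: planeJ.

Lemma planePP : planeP *m planeP = planeP.
Proof.
rewrite /planeP !(mulmxDl, mulmxDr) !mul_delta_mx_cond !eqxx.
have ba : b == a = false by rewrite eq_sym (negbTE ab).
by rewrite (negbTE ab) ba !(mulr0n, mulr1n, addr0, add0r, subr0, sub0r, oppr0, opprD, opprK).
Qed.

Lemma planePJ : planeP *m planeJ = planeJ.
Proof.
rewrite /planeP /planeJ !(mulmxDl, mulmxBr) !mul_delta_mx_cond !eqxx.
have ba : b == a = false by rewrite eq_sym (negbTE ab).
by rewrite (negbTE ab) ba !(mulr0n, mulr1n, addr0, add0r, subr0, sub0r, oppr0, opprD, opprK).
Qed.

Lemma planeJP : planeJ *m planeP = planeJ.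
Proof.
rewrite /planeP /planeJ !(mulmxBl, mulmxDr) !mul_delta_mx_cond !eqxx.
have ba : b == a = false by rewrite eq_sym (negbTE ab).
by rewrite (negbTE ab) ba !(mulr0n, mulr1n, addr0, add0r, subr0, sub0r, oppr0, opprD, opprK) 1?addrC.
Qed.

Lemma planeJJ : planeJ *m planeJ = - planeP.
Proof.
rewrite /planeP /planeJ !(mulmxBl, mulmxBr) !mul_delta_mx_cond !eqxx.
have ba : b == a = false by rewrite eq_sym (negbTE ab).
by rewrite (negbTE ab) ba !(mulr0n, mulr1n, addr0, add0r, subr0, sub0r, oppr0, opprD, opprK).
Qed.

(** On the plane this is the product of the complex numbers [c + i s] and [c' + i s']; elsewhere
    both factors are the identity. *)
Lemma rotM c s c' s' :
  plane_rot c s *m plane_rot c' s' = plane_rot (c * c' - s * s') (c * s' + s * c').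
Proof.
rewrite /plane_rot !(mulmxDl, mulmxDr) !mul1mx !mulmx1 -!scalemxAl -!scalemxAr.
rewrite planePP planePJ planeJP planeJJ.
apply/matrixP => i j; rewrite !mxE; ring.
Qed.

Lemma rotT c s : (plane_rot c s)^T = plane_rot c (- s).
Proof.
apply/matrixP => i j; rewrite /plane_rot /planeP /planeJ !mxE.
rewrite ![(j == _) && _]andbC (eq_sym j i); ring.
Qed.

Lemma rot10 : plane_rot 1 0 = 1%:M.
Proof. by rewrite /plane_rot subrr !scale0r !addr0. Qed.

Lemma rot_orthogonal (t : R) :
  plane_rot (cos t) (sin t) *m (plane_rot (cos t) (sin t))^T = 1%:M.
Proof.
rewrite rotT rotM mulrN opprK -!expr2 cos2Dsin2.
by rewrite mulrN mulrC addNr rot10.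
Qed.

(* By orthogonality the determinant is a sign; being that of the square of the
   rotation by half the angle, it is 1. *)
Lemma det_rot (t : R) : \det (plane_rot (cos t) (sin t)) = 1.
Proof.
have -> : plane_rot (cos t) (sin t) =
    plane_rot (cos (t / 2)) (sin (t / 2)) *m plane_rot (cos (t / 2)) (sin (t / 2)).
  rewrite rotM; have {1 2}-> : t = t / 2 + t / 2 by field.
  by rewrite cosD sinD [X in _ = plane_rot _ (_ + X)]mulrC [X in plane_rot _ (X + _)]mulrC.
by rewrite det_mulmx -[X in _ * X]det_tr -det_mulmx rot_orthogonal det1.
Qed.

(** For [c = cos t] and [s = sin t] the right side is the derivative of the rotation in [t]:
    [planeJ] generates the rotations. *)
Lemma rot_planeJ c s : plane_rot c s *m planeJ = c *: planeJ - s *: planeP.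
Proof.
rewrite /plane_rot !mulmxDl mul1mx -!scalemxAl planePJ planeJJ.
by apply/matrixP => i j; rewrite !mxE; ring.
Qed.

Lemma mulmx_rotE (x : 'rV[R]_n) c s :
  x *m plane_rot c s = x + (c - 1) *: (x *m planeP) + s *: (x *m planeJ).
Proof. by rewrite /plane_rot 2!mulmxDr mulmx1 -!scalemxAr. Qed.

(** Stated for any linear form, to serve both for the inner product with [y] and for a
    coordinate. *)
Lemma is_derive_rot (L : 'rV[R]_n -> R) (x : 'rV[R]_n) (t : R) :
  (forall u v, L (u + v) = L u + L v) -> (forall k u, L (k *: u) = k * L u) ->
  is_derive t 1 (fun t => L (x *m plane_rot (cos t) (sin t)))
    (L (x *m plane_rot (cos t) (sin t) *m planeJ)).
Proof.
move=> LD LZ.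
have -> : (fun t => L (x *m plane_rot (cos t) (sin t))) =
    (fun t => L x + (cos t - 1) * L (x *m planeP) + sin t * L (x *m planeJ)).
  by apply/funext => u; rewrite mulmx_rotE !LD !LZ.
have -> : x *m plane_rot (cos t) (sin t) *m planeJ =
    cos t *: (x *m planeJ) + (- sin t) *: (x *m planeP).
  by rewrite -mulmxA rot_planeJ scaleNr !scalemxAr -mulmxBr.
rewrite LD !LZ.
apply: is_derive_eq; rewrite /GRing.scale /=; ring.
Qed.

Lemma mulmx_planeJ (x : 'rV[R]_n) :
  x *m planeJ = x ord0 a *: delta_mx ord0 b - x ord0 b *: delta_mx ord0 a.
Proof.
rewrite /planeJ mulmxBr; congr (_ - _); apply/rowP => j; rewrite !mxE.
  rewrite (bigD1 a) //= big1 ?addr0; first by rewrite !mxE !eqxx.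
  by move=> i ia; rewrite !mxE (negbTE ia) mulr0.
rewrite (bigD1 b) //= big1 ?addr0; first by rewrite !mxE !eqxx.
by move=> i ib; rewrite !mxE (negbTE ib) mulr0.
Qed.

Lemma planeJ_coord (x : 'rV[R]_n) : (x *m planeJ) ord0 b = x ord0 a.
Proof.
by rewrite mulmx_planeJ !mxE !eqxx eq_sym (negbTE ab) mulr1 mulr0 subr0.
Qed.

Lemma dot_planeJ (x y : 'rV[R]_n) :
  dot (x *m planeJ) y = x ord0 a * y ord0 b - x ord0 b * y ord0 a.
Proof.
have dd i : dot (delta_mx ord0 i) y = y ord0 i.
  rewrite /dot (bigD1 i) //= big1 ?addr0; first by rewrite mxE !eqxx mul1r.
  by move=> j ji; rewrite mxE (negbTE ji) andbF mul0r.
by rewrite mulmx_planeJ -scaleNr dotDl !dotZl !dd mulNr.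
Qed.

End rotations.

(** * Moments of an inner product on the sphere *)

Section moments.
Context {R : realType} {n : nat} (sigma : probability (borel R n) R).
Hypothesis hsigma : is_sphere_measure sigma.
Variable y : 'rV[R]_n.
Local Notation E := (sE sigma).

(* The vector field [x_a d_b - x_b d_a] applied to [<x, y>^r x_b]. *)
Definition generator (a b : 'I_n) (r : nat) (x : 'rV[R]_n) : R :=
  r%:R * dot x y ^+ r.-1 * (x ord0 a * y ord0 b - x ord0 b * y ord0 a)
    * x ord0 b + dot x y ^+ r * x ord0 a.

Lemma sbounded_generator a b r : sbounded (generator a b r : borel R n -> R).
Proof.
apply: sboundedD; apply: sboundedM; try exact: sbounded_coord.
  apply: sboundedM.
    by apply: sboundedZ; apply: sboundedX; exact: sbounded_dot.
  under eq_fun do rewrite -mulNr mulrC [_ * y ord0 a]mulrC mulrN -mulNr.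
  by apply: sboundedD; apply: sboundedZ; exact: sbounded_coord.
by apply: sboundedX; exact: sbounded_dot.
Qed.

(** By invariance the mean of [h] at the point rotated by [t] does not depend on [t]. Its derivative
    at 0, taken under the integral sign, is the mean of the generator. *)
Lemma sE_generator (a b : 'I_n) (r : nat) : a != b ->
  E (generator a b r) = 0.
Proof.
move=> ab.
pose h (v : 'rV[R]_n) := dot v y ^+ r * v ord0 b.
pose d0 := generator a b r.
pose f (t : R) (x : borel R n) := h ((x : 'rV[R]_n) *m plane_rot a b (cos t) (sin t)).
have bh : sbounded (h : borel R n -> R).
  apply: sboundedM; last exact: sbounded_coord.
  by apply: sboundedX; exact: sbounded_dot.
have bd0 : sbounded (d0 : borel R n -> R) := sbounded_generator a b r.
(* The derivative at any [t] is the generator at the rotated point, which is still on the sphere;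
   one bound thus serves for all [t]. *)
have df (t : R) (x : 'rV[R]_n) :
    is_derive t 1 (f ^~ x) (d0 (x *m plane_rot a b (cos t) (sin t))).
  have d1 := @is_derive_rot R n a b ab (fun v => dot v y) x t
    (fun u v => dotDl u v y) (fun k u => dotZl k u y).
  have d2 := @is_derive_rot R n a b ab (fun v => v ord0 b) x t
    (fun u v => mxE _ _ _ _) (fun k u => mxE _ _ _ _).
  have d3 := is_deriveM (is_derive_exprn r d1) d2.
  apply: (is_derive_eq d3).
  rewrite /d0 /generator -(dot_planeJ a b) /GRing.scale /= planeJ_coord //; ring.
have [M fM] := bd0.2.
have Rot (t : R) := @rot_orthogonal R n a b ab t.
have I0 : `](-1 : R), 1[%classic (0 : R) by rewrite /= in_itv /= ltrN10 ltr01.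
have intf : forall t, `](-1 : R), 1[%classic t ->
    sigma.-integrable (@sphere R n) (EFin \o f t).
  move=> t _; apply: sbounded_integrable.
  exact: (sbounded_mulmxr (Rot t) bh).
have derf : forall t x, `](-1 : R), 1[%classic t -> @sphere R n x ->
    derivable (f ^~ x) t 1.
  by move=> t x _ _; have [] := df t x.
(* The dominating function is constant; the absolute value makes it visibly nonnegative. *)
have intG : sigma.-integrable (@sphere R n) (EFin \o (fun _ : borel R n => `|M|)).
  by apply: sbounded_integrable; exact: sbounded_cst.
have G_ub : forall t (x : borel R n), `](-1 : R), 1[%classic t -> @sphere R n x ->
    `|partial1of2 f t x| <= `|M|.
  move=> t x _ Sx; rewrite partial1of2E.
  have d := df t x; rewrite derive_val.
  apply: le_trans (ler_norm M); apply: fM.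
  by apply/sphere_orthogonal.
have := @differentiation_under_integral R _ (borel R n) sigma f (@sphere R n)
  measurable_sphere 0 (-1) 1 I0 intf derf (fun=> `|M|) (fun=> normr_ge0 M) intG G_ub.
have -> : (fun t => \int[sigma]_(x in @sphere R n) f t x) = cst (E h).
  apply/funext => t; rewrite -(sE_rot hsigma (Rot t) (@det_rot R n a b ab t) bh).
  by [].
(* The 0 on the right becomes the integral of the derivative at [t = 0], where the rotation is the
   identity. *)
rewrite derive1_cst => e; rewrite [RHS]e.
apply: eq_Rintegral => x _ /=; rewrite partial1of2E.
have d := df 0 x; rewrite derive_val.
by rewrite cos0 sin0 rot10 mulmx1.
Qed.

Definition smoment k := E (fun x : 'rV[R]_n => dot x y ^+ k).

Lemma smoment0 : smoment 0 = 1.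
Proof.
by rewrite /smoment -[RHS](sE_cst hsigma 1); apply: eq_sE.
Qed.

(* Sum [y_a * generator a b r] over [a != b] and use [|x| = |y| = 1]. *)
Lemma smoment_rec r : @sphere R n y ->
  r%:R * smoment r.-1 = (n%:R - 1 + r%:R) * smoment r.+1.
Proof.
move=> Sy.
(* The diagonal is set to 0, as a rotation needs two distinct coordinates. *)
pose g (a b : 'I_n) (x : 'rV[R]_n) := if a == b then 0 else generator a b r x.
have bg a b : sbounded (g a b : borel R n -> R).
  rewrite /g; case: eqP => _; first exact: sbounded_cst.
  exact: sbounded_generator.
have g0 a b : E (g a b) = 0.
  rewrite /g; have [_|ab] := eqVneq a b; first exact: (sE_cst hsigma 0).
  exact: sE_generator.
have bm k : sbounded ((fun x : 'rV[R]_n => dot x y ^+ k) : borel R n -> R).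
  by apply: sboundedX; exact: sbounded_dot.
have : E (fun x => \sum_a \sum_b y ord0 a * g a b x) = 0.
  rewrite (sE_sum hsigma); last first.
    by move=> a; apply: sbounded_sum => b; exact: sboundedZ.
  rewrite big1 // => a _; rewrite (sE_sum hsigma); last by move=> b; exact: sboundedZ.
  by rewrite big1 // => b _; rewrite sEZ // g0 mulr0.
have -> : E (fun x => \sum_a \sum_b y ord0 a * g a b x) =
    E (fun x : 'rV[R]_n => (n%:R - 1 + r%:R) * dot x y ^+ r.+1 + - r%:R * dot x y ^+ r.-1).
  apply: eq_sE => x Sx.
  pose u := dot x y; have uE : u = \sum_i x ord0 i * y ord0 i by [].
  (* At [a = b] the first two terms cancel and the Kronecker term removes the third, so the sums can
     run over all pairs and factor. *)
  have -> : \sum_a \sum_b y ord0 a * g a b x =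
     \sum_a \sum_b (r%:R * u ^+ r.-1 * ((x ord0 a * y ord0 a) * (x ord0 b * y ord0 b))
       - r%:R * u ^+ r.-1 * ((y ord0 a * y ord0 a) * (x ord0 b * x ord0 b))
       + (u ^+ r * (x ord0 a * y ord0 a) - (a == b)%:R * (u ^+ r * (x ord0 a * y ord0 a)))).
    apply: eq_bigr => a _; apply: eq_bigr => b _; rewrite /g /generator -/u.
    by have [->|ab] := eqVneq a b; rewrite ?mulr1n ?mulr0n; ring.
  have S1 : \sum_a \sum_b r%:R * u ^+ r.-1 * ((x ord0 a * y ord0 a) * (x ord0 b * y ord0 b))
     = r%:R * u ^+ r.-1 * (u * u).
    rewrite [X in _ = _ * (X * X)]uE mulr_suml mulr_sumr; apply: eq_bigr => a _.
    by rewrite !mulr_sumr.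
  have S2 : \sum_a \sum_b r%:R * u ^+ r.-1 * ((y ord0 a * y ord0 a) * (x ord0 b * x ord0 b))
     = r%:R * u ^+ r.-1.
    transitivity (r%:R * u ^+ r.-1 * (dot y y * dot x x)).
      rewrite /dot mulr_suml mulr_sumr; apply: eq_bigr => a _.
      by rewrite !mulr_sumr.
    by rewrite Sx Sy !mulr1.
  have S3 : \sum_a \sum_(b < n) u ^+ r * (x ord0 a * y ord0 a) = n%:R * u ^+ r.+1.
    rewrite exprSr [X in _ = _ * (_ * X)]uE !mulr_sumr; apply: eq_bigr => a _.
    by rewrite sumr_const card_ord mulr_natl.
  have S4 : \sum_a \sum_(b < n) (a == b)%:R * (u ^+ r * (x ord0 a * y ord0 a)) = u ^+ r.+1.
    rewrite exprSr [X in _ = _ * X]uE mulr_sumr; apply: eq_bigr => a _.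
    rewrite (bigD1 a) //= big1 ?addr0 ?eqxx ?mul1r // => b.
    by rewrite eq_sym => /negbTE ->; rewrite mul0r.
  transitivity (r%:R * u ^+ r.-1 * (u * u) - r%:R * u ^+ r.-1 + (n%:R * u ^+ r.+1 - u ^+ r.+1)).
    rewrite -[X in _ - X + _]S2 -S1 -S3 -S4 -!sumrB -big_split /=; apply: eq_bigr => a _.
    by rewrite -!sumrB -big_split /=.
  (* Again [r.-1] is truncated at [r = 0], where its coefficient is 0. *)
  rewrite -/u; case: (r) => [|q] /=; first by ring.
  by rewrite !exprS; ring.
rewrite sED; [|exact: sboundedZ..].
rewrite !sEZ // -/(smoment _) -/(smoment _) mulNr => /eqP.
by rewrite subr_eq0 => /eqP.
Qed.

End moments.

(** * Averages of zonal polynomials *)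

(** Both sequences start at 1 and obey the same recursion, whose coefficient [n - 1 + r] is nonzero
    and can be cancelled. *)
Lemma smoment_wmoment {R : realType} {n : nat} (sigma : probability (borel R n) R)
    (y : 'rV[R]_n) k : (2 <= n)%N -> is_sphere_measure sigma -> @sphere R n y ->
  smoment sigma y k = cn R n * wmoment n k.
Proof.
move=> n2 hs Sy.
have n1 r : n%:R - 1 + r%:R != 0 :> R.
  have : 2 <= n%:R :> R by rewrite ler_nat.
  have : 0 <= r%:R :> R by [].
  by move=> h1 h2; rewrite gt_eqF //; lra.
have step r : smoment sigma y r.-1 = cn R n * wmoment n r.-1 ->
    smoment sigma y r.+1 = cn R n * wmoment n r.+1.
  move=> IH; apply: (mulfI (n1 r)).
  by rewrite -(smoment_rec hs) // IH mulrCA wmoment_rec // mulrCA.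
have h0 : smoment sigma y 0 = cn R n * wmoment n 0.
  by rewrite (smoment0 hs) cn_wmoment.
suff [] : smoment sigma y k = cn R n * wmoment n k /\
  smoment sigma y k.+1 = cn R n * wmoment n k.+1 by [].
(* With [r = 0] the recursion goes from index [0.-1 = 0] to index 1: its left side vanishes, and so
   do both first moments. *)
elim: k => [|k [IH1 IH2]]; first by split => //; exact: (step 0%N).
by split => //; exact: (step k.+1).
Qed.

Lemma gegenbauer0E {R : realType} (n : nat) (g : {poly R}) : (2 <= n)%N ->
  gegenbauer0 n g = \sum_(i < size g) g`_i * (cn R n * wmoment n i).
Proof.
move=> n2.
(* Integrability and value are proved together, because additivity of the integral needs the tail to
   be integrable. *)
have int_sum (r : seq 'I_(size g)) :
    lebesgue_measure.-integrable `[-1, 1]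
      (fun x : R => (\sum_(i <- r) g`_i * (x ^+ i * weight n x))%:E) /\
    \int[lebesgue_measure]_(x in `[-1, 1]) (\sum_(i <- r) g`_i * (x ^+ i * weight n x))
    = \sum_(i <- r) g`_i * wmoment n i.
  elim: r => [|i r [IH1 IH2]].
    rewrite big_nil; split.
      rewrite (_ : (fun _ => _) = cst 0%E); first exact: integrable0.
      by apply/funext => x; rewrite big_nil.
    under eq_Rintegral do rewrite big_nil.
    by rewrite /Rintegral integral0.
  have h := integrableZ_mono_weight i g`_i n2.
  split.
    rewrite (_ : (fun _ => _) = (fun x : R => (g`_i * (x ^+ i * weight n x))%:E +
        (\sum_(j <- r) g`_j * (x ^+ j * weight n x))%:E)%E).
      exact: integrableD.
    by apply/funext => x; rewrite big_cons EFinD.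
  under eq_Rintegral do rewrite big_cons.
  rewrite RintegralD // big_cons IH2 RintegralZl //.
  exact: integrable_mono_weight.
rewrite /gegenbauer0 [X in _ * X](_ : _ = \sum_(i < size g) g`_i * wmoment n i).
  by rewrite mulr_sumr; apply: eq_bigr => i _; rewrite mulrCA.
rewrite -(int_sum (index_enum _)).2; apply: eq_Rintegral => x _.
by rewrite horner_coef mulr_suml; apply: eq_bigr => i _; rewrite /weight mulrA.
Qed.

Section zonal.
Context {R : realType} {n : nat} (y : 'rV[R]_n) (g : {poly R}).

(** The inner product with [y] as a polynomial in [n] variables; [mzonal] composes [g] with it, so
    that the design property, stated for such polynomials, applies. *)
Definition mlin : mpoly n R := \sum_(j < n) y ord0 j *: mpolyX R (mnm1 j).
Definition mzonal : mpoly n R := \sum_(i < size g) g`_i *: mlin ^+ i.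

Lemma peval_zonal x : peval mzonal x = g.[dot x y].
Proof.
have lin : peval mlin x = dot x y.
  rewrite /peval /mlin raddf_sum /=; apply: eq_bigr => j _.
  by rewrite mevalZ mevalXU mulrC.
rewrite horner_coef /peval /mzonal raddf_sum /=; apply: eq_bigr => i _.
by rewrite mevalZ rmorphXn /= -lin.
Qed.

Lemma msize_zonal : (msize mzonal <= size g)%N.
Proof.
have slin : (msize mlin <= 2)%N.
  apply: (leq_trans (msize_sum _ _ _)).
  apply/bigmax_leqP => j _; apply: leq_trans (msizeZ_le _ _) _.
  by rewrite msizeX mdeg1.
have sexp i : (msize (mlin ^+ i) <= i.+1)%N.
  elim: i => [|i IH]; first by rewrite expr0 msize1.
  have [->|l0] := eqVneq mlin 0; first by rewrite expr0n /= msize0.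
  rewrite exprS msizeM ?expf_neq0 //.
  move: (msize mlin) (msize (mlin ^+ i)) slin IH => u v; lia.
rewrite /mzonal; apply: (leq_trans (msize_sum _ _ _)).
apply/bigmax_leqP => i _; apply: leq_trans (msizeZ_le _ _) _.
exact: leq_trans (sexp i) (ltn_ord i).
Qed.

End zonal.

(** The zonal polynomial has degree at most that of [g], so its averages over [C] and over the
    sphere agree; the latter is computed coefficient by coefficient from the moments. *)
Lemma design_zonal_sum {R : realType} (n tau : nat) (C : {fset 'rV[R]_n})
    (y : 'rV[R]_n) (g : {poly R}) :
  (2 <= n)%N -> (0 < #|` C|)%N -> spherical_design tau C -> @sphere R n y ->
  (size g <= tau.+1)%N ->
  \sum_(x <- C) g.[dot x y] = gegenbauer0 n g * #|` C|%:R.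
Proof.
move=> n2 C0 [_ [sigma [hs hd]]] Sy sg.
have := hd (mzonal y g) (leq_trans (msize_zonal y g) sg).
under eq_bigr do rewrite peval_zonal.
under eq_Rintegral do rewrite peval_zonal.
have -> : \int[sigma]_(x in @sphere R n) g.[dot x y] = gegenbauer0 n g.
  rewrite gegenbauer0E //.
  have bm k : sbounded ((fun x : 'rV[R]_n => dot x y ^+ k) : borel R n -> R).
    by apply: sboundedX; exact: sbounded_dot.
  transitivity (sE sigma (fun x : 'rV[R]_n => \sum_(i < size g) g`_i * dot x y ^+ i)).
    by apply: eq_Rintegral => x _; rewrite horner_coef.
  rewrite (sE_sum hs); last by move=> i; exact: sboundedZ.
  by apply: eq_bigr => i _; rewrite sEZ // -(smoment_wmoment i n2 hs Sy).
by move=> <-; rewrite mulrAC mulVf ?mul1r // pnatr_eq0 -lt0n.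
Qed.

(** * The lower bound for the covering radius *)

Unset Implicit Arguments.

Theorem lemma4p5 (R : realType) (n k : nat) (C : {fset 'rV[R]_n})
    (y : 'rV[R]_n) (l s : R) (m j : nat) (g : {poly R}) (M : R)
    (hn : (2 <= n)%N) (hk : (1 <= k)%N)
    (hC : spherical_design (2 * k) C)
    (hspan : spans C)
    (hcard : (D2k n k < #|` C|)%N)
    (hy : realizes_covering_radius C y)
    (hl : -1 < l)
    (ht1 : -1 <= t_ C y 1 <= l)
    (hm : is_mC k l C m)
    (hmC : (m <= #|` C| - 1)%N)
    (hs : t_ C y (#|` C| - m) <= s < tFL R n k)
    (hj : (j + n <= m)%N)
    (hjt : t_ C y (#|` C| - m + j) < tFL R n k <= t_ C y (#|` C| - m + j + 1))
    (hg : polysB k s g)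
    (hM : is_largest
            [set t : R | j%:R * g.[tFL R n k] + (m%:R - j%:R) * g.[t]
                         = gegenbauer0 n g * #|` C|%:R] M) :
  M <= rho C.
Proof.
case: hy => Sy <-; case: hM => hM _; case/andP: ht1 => ht1 _.
(* As [n >= 2], the range of [j] leaves at least two indices in the last block, so [m - j] is
   positive. *)
have jm : (j < m)%N.
  by apply: leq_trans hj; rewrite -addn1 leq_add2l (leq_trans _ hn).
(* The degree of [g] is exactly the strength [2k] of the design. *)
have sg : (size g <= (2 * k).+1)%N by case: hg => ->.
apply: bound_of_identity hk ht1 hmC jm hs hjt hg _ hM.
exact: (design_zonal_sum hn (leq_ltn_trans (leq0n _) hcard) hC Sy sg).
Qed.
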